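(* The set of (Gödel numbers of) constructively true arithmetical sentences is $\Sigma^1_1$-hard: every $\Sigma^1_1$ set of natural numbers is many-one reducible, by a recursive function, to the set of constructively true arithmetical sentences.
   Context: Arithmetical formulas are first-order formulas in $0,1,+,\cdot,<,=$, $\neg,\wedge,\vee,\rightarrow$, $\exists,\forall$ over the natural numbers. Witnesses (continuous function realizability, essentially Kleene's function realizability) are sets of natural numbers defined by recursion on formulas with free variables assigned natural numbers: a witness for an atomic formula or for $\neg A$ exists iff the formula is true ($\neg A$ is true iff $A$ has no witness) and carries no information; for $A\wedge B$, witnesses for both; for $A\vee B$, a choice of disjunct plus a witness for it; for $\exists x\,A(x)$, a number $n$ and a witness for $A(n)$; for $\forall x\,A(x)$, on input $n$ a witness for $A(n)$; for $A\rightarrow B$, a real $W$ coding a continuous map (output determined by finite initial segments of input) such that for every witness $X$ of $A$ (arbitrary, not necessarily computable), $W_X$ is a witness for $B$. A sentence is constructively true iff it has a recursive witness. *)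

(* Defs.v *)
From Stdlib Require Import Arith List Cantor.
Import ListNotations.

Definition npair (a b : nat) : nat := Cantor.to_nat (a, b).

(** * Recursive functions and sets (mu-recursive functions) *)

Inductive prog : Type :=
| PZero : prog
| PSucc : prog
| PProj : nat -> prog
| PComp : prog -> list prog -> prog
| PRec  : prog -> prog -> prog
| PMu   : prog -> prog.

(** [eval p l v]: the partial function computed by [p] is defined at the tuple
    [l], with value [v].  Programs carry no arity; applying one to a tuple of
    an unsuitable length is undefined. *)
Inductive eval : prog -> list nat -> nat -> Prop :=
| ev_zero l : eval PZero l 0
| ev_succ n : eval PSucc [n] (S n)
| ev_proj i l v : nth_error l i = Some v -> eval (PProj i) l v
| ev_comp f gs l ws v : evals gs l ws -> eval f ws v -> eval (PComp f gs) l v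
| ev_rec0 f g l v : eval f l v -> eval (PRec f g) (0 :: l) v
| ev_recS f g n l u v :
    eval (PRec f g) (n :: l) u -> eval g (n :: u :: l) v ->
    eval (PRec f g) (S n :: l) v
| ev_mu f l n (w : nat -> nat) :
    (forall m, m < n -> eval f (m :: l) (S (w m))) -> eval f (n :: l) 0 ->
    eval (PMu f) l n
with evals : list prog -> list nat -> list nat -> Prop :=
| evs_nil l : evals [] l []
| evs_cons g gs l w ws :
    eval g l w -> evals gs l ws -> evals (g :: gs) l (w :: ws).

Definition recursive_function (f : nat -> nat) : Prop :=
  exists p, forall n, eval p [n] (f n).

Definition recursive_set (X : nat -> Prop) : Prop :=
  exists p, forall n, (X n -> eval p [n] 1) /\ (~ X n -> eval p [n] 0).

Definition many_one_reducible (S T : nat -> Prop) : Prop :=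
  exists f, recursive_function f /\ forall n, S n <-> T (f n).

(** * Arithmetical formulas, with de Bruijn variables *)

Inductive term : Type :=
| Var : nat -> term
| Zero : term
| One : term
| Add : term -> term -> term
| Mul : term -> term -> term.

Inductive form : Type :=
| Eq : term -> term -> form
| Lt : term -> term -> form
| Neg : form -> form
| And : form -> form -> form
| Or  : form -> form -> form
| Imp : form -> form -> form
| Ex  : form -> form
| All : form -> form.

Fixpoint bounded_term (k : nat) (t : term) : Prop :=
  match t with
  | Var i => i < k
  | Zero | One => True
  | Add s t | Mul s t => bounded_term k s /\ bounded_term k t
  end.

(** All free variables of [A] have an index smaller than [k]. *)
Fixpoint bounded (k : nat) (A : form) : Prop :=
  match A with
  | Eq s t | Lt s t => bounded_term k s /\ bounded_term k t
  | Neg A => bounded k A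
  | And A B | Or A B | Imp A B => bounded k A /\ bounded k B
  | Ex A | All A => bounded (S k) A
  end.

Definition sentence (A : form) : Prop := bounded 0 A.

Fixpoint term_code (t : term) : nat :=
  match t with
  | Var i => npair 0 i
  | Zero => npair 1 0
  | One => npair 2 0
  | Add s t => npair 3 (npair (term_code s) (term_code t))
  | Mul s t => npair 4 (npair (term_code s) (term_code t))
  end.

(** Goedel numbering of formulas *)
Fixpoint form_code (A : form) : nat :=
  match A with
  | Eq s t => npair 0 (npair (term_code s) (term_code t))
  | Lt s t => npair 1 (npair (term_code s) (term_code t))
  | Neg A => npair 2 (form_code A)
  | And A B => npair 3 (npair (form_code A) (form_code B))
  | Or A B => npair 4 (npair (form_code A) (form_code B))
  | Imp A B => npair 5 (npair (form_code A) (form_code B))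
  | Ex A => npair 6 (form_code A)
  | All A => npair 7 (form_code A)
  end.

Definition scons (n : nat) (e : nat -> nat) (i : nat) : nat :=
  match i with
  | 0 => n
  | S j => e j
  end.

Fixpoint term_val (e : nat -> nat) (t : term) : nat :=
  match t with
  | Var i => e i
  | Zero => 0
  | One => 1
  | Add s t => term_val e s + term_val e t
  | Mul s t => term_val e s * term_val e t
  end.

(** * Continuous maps on sets of natural numbers, coded by sets *)

Definition initial_segment (s : list bool) (X : nat -> Prop) : Prop :=
  forall i, i < length s -> (nth i s false = true <-> X i).

(** A bijection between finite binary strings and natural numbers *)
Fixpoint string_code (s : list bool) : nat :=
  match s with
  | [] => 0
  | false :: s => 2 * string_code s + 1
  | true :: s => 2 * string_code s + 2
  end.

(** A code [W] is read as follows: given the question "is [n] in the output?"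
    and a finite initial segment [s] of the input, [halts W n s] says that [s]
    suffices for an answer, and [accepts W n s] gives the answer.  On input
    [X], the answer is the one given at the shortest sufficient initial segment
    of [X]. *)
Definition halts (W : nat -> Prop) (n : nat) (s : list bool) : Prop :=
  W (npair n (npair (string_code s) 0)).

Definition accepts (W : nat -> Prop) (n : nat) (s : list bool) : Prop :=
  W (npair n (npair (string_code s) 1)).

Definition first_halt (W X : nat -> Prop) (n : nat) (s : list bool) : Prop :=
  initial_segment s X /\ halts W n s /\
  forall t, initial_segment t X -> length t < length s -> ~ halts W n t.

Definition defined (W X : nat -> Prop) : Prop :=
  forall n, exists s, first_halt W X n s.

Definition app (W X : nat -> Prop) : nat -> Prop :=
  fun n => exists s, first_halt W X n s /\ accepts W n s.

(** * Witnesses *)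

(** Codings: [X] codes the pair of sets [{k | 2k in X}], [{k | 2k+1 in X}];
    the pair of the truth value of [0 in X] and the set [{k | k+1 in X}];
    if nonempty with least element [n], the pair of [n] and
    [{k | n+1+k in X}]; and the sequence of sets [{k | <n,k> in X}], [n] in
    [nat]. *)
Fixpoint witness (A : form) (e : nat -> nat) (X : nat -> Prop) : Prop :=
  match A with
  | Eq s t => term_val e s = term_val e t
  | Lt s t => term_val e s < term_val e t
  | Neg A => ~ exists Y, witness A e Y
  | And A B =>
      witness A e (fun k => X (2 * k)) /\ witness B e (fun k => X (2 * k + 1))
  | Or A B =>
      (X 0 /\ witness A e (fun k => X (S k))) \/
      (~ X 0 /\ witness B e (fun k => X (S k)))
  | Imp A B =>
      forall Y, witness A e Y -> defined X Y /\ witness B e (app X Y)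
  | Ex A =>
      exists n, X n /\ (forall m, m < n -> ~ X m) /\
        witness A (scons n e) (fun k => X (n + 1 + k))
  | All A =>
      forall n, witness A (scons n e) (fun k => X (npair n k))
  end.

(** The assignment [fun _ => 0] is irrelevant for sentences. *)
Definition constructively_true (A : form) : Prop :=
  sentence A /\ exists W, recursive_set W /\ witness A (fun _ => 0) W.

Definition constructively_true_codes (m : nat) : Prop :=
  exists A, form_code A = m /\ constructively_true A.

(** * Lightface Sigma^1_1 sets *)

(** Formulas of second-order arithmetic without set quantifiers; [Mem2 t i]
    says that [t] belongs to the [i]-th set variable. *)
Inductive form2 : Type :=
| Eq2 : term -> term -> form2
| Lt2 : term -> term -> form2
| Mem2 : term -> nat -> form2
| Neg2 : form2 -> form2
| And2 : form2 -> form2 -> form2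
| Or2  : form2 -> form2 -> form2
| Imp2 : form2 -> form2 -> form2
| Ex2  : form2 -> form2
| All2 : form2 -> form2.

Fixpoint sat2 (X : nat -> nat -> Prop) (e : nat -> nat) (A : form2) : Prop :=
  match A with
  | Eq2 s t => term_val e s = term_val e t
  | Lt2 s t => term_val e s < term_val e t
  | Mem2 t i => X i (term_val e t)
  | Neg2 A => ~ sat2 X e A
  | And2 A B => sat2 X e A /\ sat2 X e B
  | Or2 A B => sat2 X e A \/ sat2 X e B
  | Imp2 A B => sat2 X e A -> sat2 X e B
  | Ex2 A => exists n, sat2 X (scons n e) A
  | All2 A => forall n, sat2 X (scons n e) A
  end.

(** The matrix mentions only finitely many set variables, so the quantifier
    over [X] amounts to a block [exists X_0 ... exists X_k].  Number variables
    other than the first one are set to 0. *)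
Definition Sigma11 (S : nat -> Prop) : Prop :=
  exists A : form2, forall n,
    S n <-> exists X : nat -> nat -> Prop, sat2 X (scons n (fun _ => 0)) A.

(* Main.v *)
(** Write a Sigma^1_1 set as the set of [n] such that a primitive recursive tree [T_n] has an
    infinite path, let [phi] be a universal partial recursive function and put
    [P_b(e) := phi_e(e) = <d,b>] for some node [d] of [T_n].  The sentence assigned to [n] is
      [(forall e, A(e) -> I(e)) -> forall e exists z, phi_e(e) <> z],
    where [I(e) := ~P_0(e) \/ ~P_1(e)], and [A(e)] says that, for every [j], either there is a [y]
    such that, if [phi_e(e) = <d,b>] with [d] in [T_n], then [y] is the [j]-th entry of [d]; or
    [I(e)].  The conclusion has no recursive witness.
    If [T_n] has no path, the premise has a recursive witness: given a witness of [A(e)], read off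
    the numbers [y] until a witness of [I(e)] shows up or the tree is left; in the latter case
    [phi_e(e)] is not of the form [<d,b>] with [d] in [T_n], so both disjuncts of [I(e)] hold.
    Hence the sentence has no recursive witness.
    If [T_n] has a path, let [X] be any witness of the premise.  Search for a stage at which
    [phi_e(e)] is defined (then return another value), or for a node [d] such that [X], on a witness
    of [A(e)] listing [d], claims [~P_b(e)] before having seen more; then return [<d,b>].  If
    [phi_e(e)] were [<d,b>], the list [d] could be completed to a witness of [A(e)], and the claim
    of [X] would be false.  If [phi_e(e)] is undefined, then a path yields a witness of [A(e)],
    so the search succeeds. *)
From Stdlib Require Import Arith List Cantor Lia ZArith Znumtheory.
From Stdlib Require Import Classical IndefiniteDescription FunctionalExtensionality PropExtensionality.
Require Import Defs.
Import ListNotations.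
Local Open Scope nat_scope.
Local Open Scope bool_scope.

(** * Primitive recursive functions *)

Definition env := nat -> nat.

(** The class is relative to base functions [B]: with [recursive_function] it yields programs, with
    [no_base] arithmetical definitions. A fact proved for all [B] serves both ends. *)
Inductive PR (B : (nat -> nat) -> Prop) : nat -> (env -> nat) -> Prop :=
| pr_var k i : i < k -> PR B k (fun e => e i)
| pr_zero k : PR B k (fun _ => 0)
| pr_succ k F : PR B k F -> PR B k (fun e => S (F e))
| pr_base k f F : B f -> PR B k F -> PR B k (fun e => f (F e))
| pr_let k F G : PR B k G -> PR B (S k) F -> PR B k (fun e => F (scons (G e) e))
| pr_ren m k (r : nat -> nat) F :
    PR B m F -> (forall i, i < m -> r i < k) -> PR B k (fun e => F (fun i => e (r i)))
| pr_rec k F G H :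
    PR B k F -> PR B (S (S k)) G -> PR B k H ->
    PR B k (fun e => nat_rect (fun _ => nat) (F e)
                       (fun n u => G (scons n (scons u e))) (H e))
| pr_ext k F G : PR B k F -> (forall e, F e = G e) -> PR B k G.

Definition no_base (f : nat -> nat) : Prop := False.

(** Environments are infinite, but only the first [k] variables matter; this identifies renamed
    environments that agree just there. *)
Lemma PR_local B k F :
  PR B k F -> forall e e' : env, (forall i, i < k -> e i = e' i) -> F e = F e'.
Proof.
  induction 1 as [k i Hi|k|k F _ IH|k f F _ _ IH|k F G _ IHG _ IHF
    |m k r F _ IH Hr|k F G H _ IHF _ IHG _ IHH|k F G _ IH E]; intros e e' He.
  - now apply He.
  - reflexivity.
  - f_equal. now apply IH.
  - f_equal. now apply IH.
  - rewrite (IHG e e' He). apply IHF. intros [|i] Hi; cbn; auto. apply He; lia.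
  - apply IH. intros i Hi. now apply He, Hr.
  - rewrite (IHF e e' He), (IHH e e' He).
    induction (H e') as [|n IHn]; cbn; auto.
    rewrite IHn. apply IHG. intros [|[|i]] Hi; cbn; auto. apply He; lia.
  - rewrite <- !E. auto.
Qed.

Lemma map_scons n (e : env) k : n :: map e (seq 0 k) = map (scons n e) (seq 0 (S k)).
Proof. cbn. f_equal. rewrite <- seq_shift, map_map. reflexivity. Qed.

Lemma evals_proj (r : nat -> nat) l (w : nat -> nat) is :
  (forall i, In i is -> nth_error l (r i) = Some (w i)) ->
  evals (map (fun i => PProj (r i)) is) l (map w is).
Proof. induction is as [|i is IH]; intros H; constructor; [constructor|]; firstorder. Qed.

Lemma nth_error_map_seq (e : env) i k : i < k -> nth_error (map e (seq 0 k)) i = Some (e i).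
Proof.
  intros H. rewrite nth_error_map, (nth_error_nth' _ 0) by now rewrite length_seq.
  cbn. now rewrite seq_nth.
Qed.

Lemma PR_computable k F :
  PR recursive_function k F -> exists p, forall e, eval p (map e (seq 0 k)) (F e).
Proof.
  induction 1 as [k i Hi|k|k F _ [p IH]|k f F [q Hq] _ [p IH]|k F G _ [q IHG] _ [p IHF]
    |m k r F _ [p IH] Hr|k F G H HF [p IHF] HG [q IHG] HH [s IHH]|k F G _ [p IH] E].
  - exists (PProj i). intros e. constructor. now apply nth_error_map_seq.
  - exists PZero. constructor.
  - exists (PComp PSucc [p]). intros e. repeat econstructor. apply IH.
  - exists (PComp q [p]). intros e. repeat econstructor; eauto.
  - exists (PComp p (q :: map (fun i => PProj i) (seq 0 k))). intros e.
    apply ev_comp with (ws := G e :: map e (seq 0 k)).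
    + constructor; [apply IHG|].
      apply (evals_proj (fun i => i)). intros i Hi%in_seq. apply nth_error_map_seq. lia.
    + rewrite map_scons. apply IHF.
  - exists (PComp p (map (fun i => PProj (r i)) (seq 0 m))). intros e.
    econstructor; [|apply IH].
    apply evals_proj. intros i Hi%in_seq. apply nth_error_map_seq, Hr. lia.
  - exists (PComp (PRec p q) (s :: map (fun i => PProj i) (seq 0 k))). intros e.
    apply ev_comp with (ws := H e :: map e (seq 0 k)).
    + constructor; [apply IHH|].
      apply (evals_proj (fun i => i)). intros i Hi%in_seq. apply nth_error_map_seq. lia.
    + induction (H e) as [|n IHn]; cbn [nat_rect].
      * constructor. apply IHF.
      * econstructor; [apply IHn|].
        rewrite 2 map_scons. apply IHG.
  - exists p. intros e. rewrite <- E. apply IH.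
Qed.

Lemma PR_recursive f : PR recursive_function 1 (fun e => f (e 0)) -> recursive_function f.
Proof.
  intros [p Hp]%PR_computable. exists p. intros n. exact (Hp (fun _ => n)).
Qed.

(** * Closure properties of the primitive recursive functions *)

Notation pr1 f := (forall B, PR B 1 (fun e => f (e 0))).
Notation pr2 f := (forall B, PR B 2 (fun e => f (e 0) (e 1))).
Notation pr3 f := (forall B, PR B 3 (fun e => f (e 0) (e 1) (e 2))).
Notation prb1 f := (forall B, PR B 1 (fun e => Nat.b2n (f (e 0)))).
Notation prb2 f := (forall B, PR B 2 (fun e => Nat.b2n (f (e 0) (e 1)))).
Notation prb3 f := (forall B, PR B 3 (fun e => Nat.b2n (f (e 0) (e 1) (e 2)))).

Section Closure.
Variable B : (nat -> nat) -> Prop.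

Lemma pr_const k c : PR B k (fun _ => c).
Proof. induction c; [apply pr_zero|now apply (pr_succ B k (fun _ => c))]. Qed.

Lemma pr_weaken k F : PR B k F -> PR B (S k) (fun e => F (fun i => e (S i))).
Proof. intros H. apply (pr_ren B k (S k) S); auto. lia. Qed.

Lemma pr_app1 k f a : PR B 1 (fun e => f (e 0)) -> PR B k a -> PR B k (fun e => f (a e)).
Proof.
  intros Hf Ha. apply (pr_let B k (fun e => f (e 0)) a Ha).
  refine (pr_ren B 1 (S k) (fun _ => 0) (fun e => f (e 0)) Hf _). lia.
Qed.

Lemma pr_app2 k f a b :
  PR B 2 (fun e => f (e 0) (e 1)) -> PR B k a -> PR B k b -> PR B k (fun e => f (a e) (b e)).
Proof.
  intros Hf Ha Hb. apply (pr_let B k (fun e => f (e 0) (b (fun i => e (S i)))) a Ha).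
  apply (pr_let B (S k) (fun e => f (e 1) (e 0)) _ (pr_weaken _ _ Hb)).
  (* The argument bound last sits at variable 0, so the arguments arrive in reverse order; [1 - i]
     restores it. *)
  refine (pr_ren B 2 _ (fun i => 1 - i) (fun e => f (e 0) (e 1)) Hf _). lia.
Qed.

Lemma pr_app3 k f a b c :
  PR B 3 (fun e => f (e 0) (e 1) (e 2)) -> PR B k a -> PR B k b -> PR B k c ->
  PR B k (fun e => f (a e) (b e) (c e)).
Proof.
  intros Hf Ha Hb Hc.
  apply (pr_let B k (fun e => f (e 0) (b (fun i => e (S i))) (c (fun i => e (S i)))) a Ha).
  apply (pr_let B (S k) (fun e => f (e 1) (e 0) (c (fun i => e (S (S i))))) _ (pr_weaken _ _ Hb)).
  apply (pr_let B (S (S k)) (fun e => f (e 2) (e 1) (e 0)) _ (pr_weaken _ _ (pr_weaken _ _ Hc))).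
  refine (pr_ren B 3 _ (fun i => 2 - i) (fun e => f (e 0) (e 1) (e 2)) Hf _). lia.
Qed.

Lemma pr_app4 k f a b c d :
  PR B 4 (fun e => f (e 0) (e 1) (e 2) (e 3)) -> PR B k a -> PR B k b -> PR B k c -> PR B k d ->
  PR B k (fun e => f (a e) (b e) (c e) (d e)).
Proof.
  intros Hf Ha Hb Hc Hd.
  apply (pr_let B k (fun e => f (e 0) (b (fun i => e (S i))) (c (fun i => e (S i)))
    (d (fun i => e (S i)))) a Ha).
  apply (pr_let B (S k) (fun e => f (e 1) (e 0) (c (fun i => e (S (S i))))
    (d (fun i => e (S (S i))))) _ (pr_weaken _ _ Hb)).
  apply (pr_let B (S (S k)) (fun e => f (e 2) (e 1) (e 0) (d (fun i => e (S (S (S i)))))) _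
    (pr_weaken _ _ (pr_weaken _ _ Hc))).
  apply (pr_let B (S (S (S k))) (fun e => f (e 3) (e 2) (e 1) (e 0)) _
    (pr_weaken _ _ (pr_weaken _ _ (pr_weaken _ _ Hd)))).
  refine (pr_ren B 4 _ (fun i => 3 - i) (fun e => f (e 0) (e 1) (e 2) (e 3)) Hf _). lia.
Qed.

Lemma pr_nat_rect k f g h :
  PR B k f -> PR B (S (S k)) (fun e => g (fun i => e (S (S i))) (e 0) (e 1)) -> PR B k h ->
  PR B k (fun e => nat_rect (fun _ => nat) (f e) (g e) (h e)).
Proof. intros Hf Hg Hh. exact (pr_rec B k f _ h Hf Hg Hh). Qed.

Lemma pr_if k t a b :
  PR B k (fun e => Nat.b2n (t e)) -> PR B k a -> PR B k b ->
  PR B k (fun e => if t e then a e else b e).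
Proof.
  intros Ht Ha Hb.
  (* Recursion on the test value 0 or 1: the base case is [b], and the step ignores its arguments
     and returns [a]. *)
  eapply pr_ext; [apply (pr_nat_rect k b (fun e _ _ => a e) (fun e => Nat.b2n (t e))); auto|].
  - now do 2 apply pr_weaken in Ha.
  - intros e. cbn. now destruct (t e).
Qed.

Lemma pr_if_bool k t a b :
  PR B k (fun e => Nat.b2n (t e)) -> PR B k (fun e => Nat.b2n (a e)) ->
  PR B k (fun e => Nat.b2n (b e)) -> PR B k (fun e => Nat.b2n (if t e then a e else b e)).
Proof.
  intros Ht Ha Hb. eapply pr_ext; [exact (pr_if k t _ _ Ht Ha Hb)|].
  intros e. cbn. now destruct (t e).
Qed.

Lemma pr_andb k a b :
  PR B k (fun e => Nat.b2n (a e)) -> PR B k (fun e => Nat.b2n (b e)) ->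
  PR B k (fun e => Nat.b2n (a e && b e)).
Proof.
  intros Ha Hb. exact (pr_if_bool k a b (fun _ => false) Ha Hb (pr_const k 0)).
Qed.

Lemma pr_orb k a b :
  PR B k (fun e => Nat.b2n (a e)) -> PR B k (fun e => Nat.b2n (b e)) ->
  PR B k (fun e => Nat.b2n (a e || b e)).
Proof.
  intros Ha Hb. exact (pr_if_bool k a (fun _ => true) b Ha (pr_const k 1) Hb).
Qed.

Lemma pr_negb k a : PR B k (fun e => Nat.b2n (a e)) -> PR B k (fun e => Nat.b2n (negb (a e))).
Proof.
  intros Ha. exact (pr_if_bool k a (fun _ => false) (fun _ => true) Ha (pr_const k 0) (pr_const k 1)).
Qed.
End Closure.

Fixpoint ball (n : nat) (f : nat -> bool) : bool :=
  match n with 0 => true | S n => if f n then ball n f else false end.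

Lemma ball_spec n f : ball n f = true <-> forall i, i < n -> f i = true.
Proof.
  induction n as [|n IH]; cbn; [split; auto; lia|].
  destruct (f n) eqn:E; [rewrite IH|].
  - split; intros H i Hi; [destruct (Nat.eq_dec i n) as [->|]; auto|]; apply H; lia.
  - split; [easy|]. intros H. rewrite <- E. apply H. lia.
Qed.

Lemma pr_ball B k h g :
  PR B k h -> PR B (S k) (fun e => Nat.b2n (g (fun i => e (S i)) (e 0))) ->
  PR B k (fun e => Nat.b2n (ball (h e) (g e))).
Proof.
  intros Hh Hg.
  apply (pr_ext B k (fun e => nat_rect (fun _ => nat) 1 (fun n u => if g e n then u else 0) (h e))).
  - apply (pr_nat_rect B k (fun _ => 1) (fun e n u => if g e n then u else 0) h);
      [apply pr_const| |exact Hh].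
    apply (pr_if B _ (fun e => g (fun i => e (S (S i))) (e 0)) (fun e => e 1));
      [|apply pr_var; lia|apply pr_zero].
    refine (pr_ren B (S k) (S (S k)) (fun i => match i with 0 => 0 | S i => S (S i) end) _ Hg _).
    intros [|i]; lia.
  - intros e. induction (h e) as [|n IH]; cbn; [easy|]. rewrite IH. now destruct (g e n).
Qed.

Create HintDb pr.
Create HintDb pr_goal.

(* Three-argument patterns come first, since [?f (@?a e)] also matches a partial application. *)
Ltac pr :=
  cbv beta; first [solve [auto 1 with pr_goal] |
  lazymatch goal with
  | |- PR _ _ (fun e => e ?i) => apply pr_var; lia
  | |- PR _ _ (fun _ => ?c) => apply pr_const
  | |- PR _ _ (fun e => S (@?a e)) => apply (pr_succ _ _ a); pr
  | |- PR _ _ (fun e => Nat.b2n (andb (@?a e) (@?b e))) => apply (pr_andb _ _ a b); pr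
  | |- PR _ _ (fun e => Nat.b2n (orb (@?a e) (@?b e))) => apply (pr_orb _ _ a b); pr
  | |- PR _ _ (fun e => Nat.b2n (negb (@?a e))) => apply (pr_negb _ _ a); pr
  | |- PR _ _ (fun e => Nat.b2n (if @?t e then @?a e else @?b e)) =>
      apply (pr_if_bool _ _ t a b); pr
  | |- PR _ _ (fun e => if @?t e then @?a e else @?b e) => apply (pr_if _ _ t a b); pr
  | |- PR _ _ (fun e => Nat.b2n (ball (@?h e) (fun i => @?g e i))) => apply (pr_ball _ _ h g); pr
  | |- PR _ _ (fun e => nat_rect _ (@?f e) (fun n u => @?g e n u) (@?h e)) =>
      apply (pr_nat_rect _ _ f g h); pr
  | |- PR _ _ (fun e => Nat.b2n (?f (@?a e) (@?b e) (@?c e))) =>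
      apply (pr_app3 _ _ (fun x y z => Nat.b2n (f x y z)) a b c); [solve [auto with pr]|pr|pr|pr]
  | |- PR _ _ (fun e => Nat.b2n (?f (@?a e) (@?b e))) =>
      apply (pr_app2 _ _ (fun x y => Nat.b2n (f x y)) a b); [solve [auto with pr]|pr|pr]
  | |- PR _ _ (fun e => Nat.b2n (?f (@?a e))) =>
      apply (pr_app1 _ _ (fun x => Nat.b2n (f x)) a); [solve [auto with pr]|pr]
  | |- PR _ _ (fun e => ?f (@?a e) (@?b e) (@?c e)) =>
      apply (pr_app3 _ _ f a b c); [solve [auto with pr]|pr|pr|pr]
  | |- PR _ _ (fun e => ?f (@?a e) (@?b e)) =>
      apply (pr_app2 _ _ f a b); [solve [auto with pr]|pr|pr]
  | |- PR _ _ (fun e => ?f (@?a e)) => apply (pr_app1 _ _ f a); [solve [auto with pr]|pr]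
  end].

Lemma pr_add : pr2 Nat.add.
Proof.
  intros B.
  apply (pr_ext B 2 (fun e => nat_rect (fun _ => nat) (e 1) (fun n u => S u) (e 0))); [pr|].
  intros e. induction (e 0) as [|n IH]; cbn; auto.
Qed.

Lemma pr_mul : pr2 Nat.mul.
Proof.
  intros B. pose proof (pr_add B).
  apply (pr_ext B 2 (fun e => nat_rect (fun _ => nat) 0 (fun n u => e 1 + u) (e 0))); [pr|].
  intros e. induction (e 0) as [|n IH]; cbn; auto.
Qed.

Lemma pr_pred : pr1 Nat.pred.
Proof.
  intros B. apply (pr_ext B 1 (fun e => nat_rect (fun _ => nat) 0 (fun n u => n) (e 0))); [pr|].
  intros e. now destruct (e 0).
Qed.

Lemma pr_sub : pr2 Nat.sub.
Proof.
  intros B. pose proof (pr_pred B).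
  apply (pr_ext B 2 (fun e => nat_rect (fun _ => nat) (e 0) (fun n u => Nat.pred u) (e 1))); [pr|].
  intros e. induction (e 1) as [|n IH]; cbn; [lia|]. rewrite IH. lia.
Qed.

Lemma pr_pow : pr2 Nat.pow.
Proof.
  intros B. pose proof (pr_mul B).
  apply (pr_ext B 2 (fun e => nat_rect (fun _ => nat) 1 (fun n u => e 0 * u) (e 1))); [pr|].
  intros e. induction (e 1) as [|n IH]; cbn; [easy|]. now rewrite IH.
Qed.

Lemma pr_leb : prb2 Nat.leb.
Proof.
  intros B. pose proof (pr_sub B).
  apply (pr_ext B 2 (fun e => 1 - (e 0 - e 1))); [pr|].
  intros e. destruct (Nat.leb_spec (e 0) (e 1)); cbn [Nat.b2n]; lia.
Qed.

Lemma pr_ltb : prb2 Nat.ltb.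
Proof. intros B. unfold Nat.ltb. pose proof (pr_leb B). pr. Qed.

Lemma pr_eqb : prb2 Nat.eqb.
Proof.
  intros B. pose proof (pr_leb B).
  apply (pr_ext B 2 (fun e => Nat.b2n (Nat.leb (e 0) (e 1) && Nat.leb (e 1) (e 0)))); [pr|].
  intros e. destruct (Nat.leb_spec (e 0) (e 1)), (Nat.leb_spec (e 1) (e 0)),
    (Nat.eqb_spec (e 0) (e 1)); cbn; lia.
Qed.

#[local] Hint Resolve pr_add pr_mul pr_pred pr_sub pr_pow pr_leb pr_ltb pr_eqb : pr.

Lemma pr_nat_iter B k f a h :
  PR B k a -> PR B k h -> PR B (S (S k)) (fun e => f (fun i => e (S (S i))) (e 1)) ->
  PR B k (fun e => Nat.iter (h e) (f e) (a e)).
Proof.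
  intros Ha Hh Hf. exact (pr_nat_rect B k a (fun e _ u => f e u) h Ha Hf Hh).
Qed.

(** * Cantor pairing and sequence numbers *)

Lemma npair_inj a b c d : npair a b = npair c d -> a = c /\ b = d.
Proof. unfold npair. intros H%Cantor.to_nat_inj. now injection H. Qed.

Definition fst_of (n : nat) : nat := fst (Cantor.of_nat n).
Definition snd_of (n : nat) : nat := snd (Cantor.of_nat n).

Lemma fst_of_npair a b : fst_of (npair a b) = a.
Proof. unfold fst_of, npair. now rewrite Cantor.cancel_of_to. Qed.

Lemma snd_of_npair a b : snd_of (npair a b) = b.
Proof. unfold snd_of, npair. now rewrite Cantor.cancel_of_to. Qed.

Lemma npair_of n : npair (fst_of n) (snd_of n) = n.
Proof. unfold fst_of, snd_of, npair. rewrite <- surjective_pairing. apply Cantor.cancel_to_of. Qed.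

Definition triangle (n : nat) : nat := nat_rect (fun _ => nat) 0 (fun i m => S i + m) n.

Lemma triangle_S n : triangle (S n) = S n + triangle n.
Proof. reflexivity. Qed.

Lemma triangle_le a b : a <= b -> triangle a <= triangle b.
Proof. induction 1; [easy|]. rewrite triangle_S. lia. Qed.

Lemma npair_triangle a b : npair a b = b + triangle (b + a).
Proof. reflexivity. Qed.

Lemma npair_ge a b : a <= npair a b /\ b <= npair a b.
Proof.
  rewrite npair_triangle. enough (b + a <= triangle (b + a)) by lia.
  induction (b + a); [|rewrite triangle_S]; lia.
Qed.

Lemma npair_mono a b b' : b < b' -> npair a b < npair a b'.
Proof.
  intros H. rewrite !npair_triangle.
  pose proof (triangle_le (b + a) (b' + a)). lia.
Qed.

Lemma fst_of_le n : fst_of n <= n.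
Proof. rewrite <- (npair_of n) at 2. apply npair_ge. Qed.

Lemma pr_triangle : pr1 triangle.
Proof. intros B. unfold triangle. pr. Qed.
#[local] Hint Resolve pr_triangle : pr.

Lemma pr_npair : pr2 npair.
Proof.
  intros B. apply (pr_ext B 2 (fun e => e 1 + triangle (e 1 + e 0))); [pr|]. reflexivity.
Qed.

(* The index [fst_of n + snd_of n] of the diagonal of [n]. *)
Definition diag_of (n : nat) : nat :=
  nat_rect (fun _ => nat) 0 (fun i s => if triangle (S s) <=? S i then S s else s) n.

Lemma diag_of_spec n : triangle (diag_of n) <= n < triangle (S (diag_of n)).
Proof.
  induction n as [|n IH]; [cbn; lia|].
  change (diag_of (S n)) with
    (if triangle (S (diag_of n)) <=? S n then S (diag_of n) else diag_of n).
  destruct (Nat.leb_spec (triangle (S (diag_of n))) (S n)); rewrite ?triangle_S in *; lia.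
Qed.

Lemma diag_of_eq n : diag_of n = fst_of n + snd_of n.
Proof.
  pose proof (diag_of_spec n) as H. pose proof (npair_of n) as E. rewrite npair_triangle in E.
  destruct (Nat.lt_trichotomy (diag_of n) (snd_of n + fst_of n)) as [L|[L|L]]; [|lia|];
    apply triangle_le in L; rewrite triangle_S in *; lia.
Qed.

Lemma pr_diag_of : pr1 diag_of.
Proof. intros B. unfold diag_of. pr. Qed.
#[local] Hint Resolve pr_npair pr_diag_of : pr.

Lemma pr_snd_of : pr1 snd_of.
Proof.
  intros B. apply (pr_ext B 1 (fun e => e 0 - triangle (diag_of (e 0)))); [pr|].
  intros e. rewrite diag_of_eq, Nat.add_comm. pose proof (npair_of (e 0)) as E.
  rewrite npair_triangle in E. lia.
Qed.
#[local] Hint Resolve pr_snd_of : pr.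

Lemma pr_fst_of : pr1 fst_of.
Proof.
  intros B. apply (pr_ext B 1 (fun e => diag_of (e 0) - snd_of (e 0))); [pr|].
  intros e. rewrite diag_of_eq. lia.
Qed.
#[local] Hint Resolve pr_fst_of : pr.

(* Every number codes an infinite sequence: [get c j] is the [j]-th term. *)
Definition get (c j : nat) : nat := fst_of (Nat.iter j snd_of c).

Lemma get_npair_0 a c : get (npair a c) 0 = a.
Proof. apply fst_of_npair. Qed.

Lemma get_npair_S a c j : get (npair a c) (S j) = get c j.
Proof. unfold get. now rewrite Nat.iter_succ_r, snd_of_npair. Qed.

Lemma get_surj (G : nat -> nat) m : exists c, forall j, j < m -> get c j = G j.
Proof.
  revert G. induction m as [|m IH]; intros G; [exists 0; lia|].
  destruct (IH (fun j => G (S j))) as [c Hc]. exists (npair (G 0) c).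
  intros [|j] Hj; [apply get_npair_0|]. rewrite get_npair_S. apply Hc. lia.
Qed.

Lemma pr_get : pr2 get.
Proof.
  intros B. unfold get. apply (pr_app1 _ _ fst_of (fun e => Nat.iter (e 1) snd_of (e 0))); [pr|].
  apply pr_nat_iter with (f := fun _ => snd_of); pr.
Qed.
#[local] Hint Resolve pr_get : pr.

(** * Arithmetical definability *)

Lemma rel_prime_prod (m : nat -> Z) N x :
  (forall i, i < N -> rel_prime x (m i)) ->
  rel_prime x (nat_rect (fun _ => Z) 1%Z (fun i p => p * m i)%Z N).
Proof.
  induction N as [|N IH]; intros H; cbn; [apply rel_prime_sym, rel_prime_1|].
  apply rel_prime_mult; auto.
Qed.

Lemma chinese_remainder (m r : nat -> Z) N :
  (forall i j, i < j -> j < N -> rel_prime (m j) (m i)) ->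
  exists a, forall i, i < N -> (m i | a - r i)%Z.
Proof.
  set (P := nat_rect (fun _ => Z) 1%Z (fun i p => p * m i)%Z).
  assert (HP : forall n i, i < n -> (m i | P n)%Z).
  { induction n as [|n IH]; intros i Hi; [lia|]. cbn.
    destruct (Nat.eq_dec i n) as [->|]; [apply Z.divide_factor_r|].
    apply Z.divide_mul_l, IH. lia. }
  induction N as [|N IH]; intros H; [exists 0%Z; lia|].
  destruct IH as [a Ha]; [auto|].
  destruct (rel_prime_bezout (m N) (P N)) as [u v E]; [apply rel_prime_prod; auto|].
  (* By Bézout, [u * m N + v * P N = 1], so [v * P N] is 1 modulo the new modulus and 0 modulo all
     earlier ones. *)
  exists (a + v * P N * (r N - a))%Z. intros i Hi.
  destruct (Nat.eq_dec i N) as [->|].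
  - exists (u * (a - r N))%Z. replace (v * P N)%Z with (1 - u * m N)%Z by lia. ring.
  - destruct (HP N i) as [q Hq]; [lia|]. destruct (Ha i) as [q' Hq']; [lia|].
    exists (q' + v * q * (r N - a))%Z. rewrite Hq.
    replace (a + v * (q * m i) * (r N - a) - r i)%Z
      with (a - r i + v * (q * m i) * (r N - a))%Z by ring.
    rewrite Hq'. ring.
Qed.

(** Gödel's β function as a relation: [v] is the remainder of [a] modulo [1 + (i + 1) * b]. Division
    is replaced by a quantified quotient so that the relation is directly arithmetical. *)
Definition beta (a b i v : nat) : Prop :=
  v < 1 + (i + 1) * b /\ exists q, a = q * (1 + (i + 1) * b) + v.

Lemma beta_fun a b i v v' : beta a b i v -> beta a b i v' -> v = v'.
Proof.
  intros [Hv [q E]] [Hv' [q' E']]. rewrite E in E'.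
  rewrite !(Nat.mul_comm _ (1 + _)) in E'.
  now destruct (Nat.div_mod_unique _ _ _ _ _ Hv Hv' E').
Qed.

Lemma beta_exists (f : nat -> nat) N : exists a b, forall i, i < N -> beta a b i (f i).
Proof.
  assert (HM : exists M, N <= M /\ forall i, i < N -> f i <= M).
  { induction N as [|N [M [H1 H2]]]; [exists 0; split; lia|].
    exists (S M + f N). split; [lia|]. intros i Hi.
    destruct (Nat.eq_dec i N) as [->|]; [lia|]. specialize (H2 i ltac:(lia)). lia. }
  destruct HM as [M [HN Hf]].
  (* Every modulus is prime to [M!], and every difference [j - i] of indices below [N] divides [M!];
     this makes the moduli pairwise coprime. They also exceed [M], hence all values. *)
  set (b := fact M).
  assert (Hb : forall d, 0 < d <= M -> (Z.of_nat d | Z.of_nat b)%Z).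
  { intros d Hd. unfold b. clear - Hd. induction M as [|M IH]; [lia|].
    cbn [fact]. replace (fact M + M * fact M) with (S M * fact M) by lia.
    rewrite Nat2Z.inj_mul. destruct (Nat.eq_dec d (S M)) as [->|].
    - apply Z.divide_factor_l.
    - apply Z.divide_mul_r, IH. lia. }
  assert (Mb : M <= b).
  { unfold b. clear. induction M as [|M IH]; [lia|].
    pose proof (lt_O_fact M). cbn [fact]. nia. }
  destruct (chinese_remainder (fun i => Z.of_nat (1 + (i + 1) * b)) (fun i => Z.of_nat (f i)) N)
    as [a Ha].
  { intros i j Hij Hj.
    set (x := Z.of_nat (1 + (j + 1) * b)).
    assert (Hx : rel_prime x (Z.of_nat b)).
    { apply bezout_rel_prime, Bezout_intro with (u := 1%Z) (v := (- Z.of_nat (j + 1))%Z).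
      unfold x. lia. }
    assert (Hd : rel_prime x (Z.of_nat (j - i))).
    { apply rel_prime_sym, (rel_prime_div (Z.of_nat b)); [now apply rel_prime_sym|].
      apply Hb. lia. }
    destruct (rel_prime_bezout _ _ (rel_prime_mult _ _ _ Hx Hd)) as [u v E].
    (* The two moduli differ by [(j - i) * b], so a Bézout identity for [x] and this product turns
       into one for the moduli. *)
    apply bezout_rel_prime, Bezout_intro with (u := (u + v)%Z) (v := (- v)%Z).
    rewrite <- E. unfold x. replace (Z.of_nat (j - i)) with (Z.of_nat j - Z.of_nat i)%Z by lia. lia. }
  (* The Chinese remainder is only an integer; reducing it modulo the product of all moduli makes it
     a natural number. *)
  set (p := nat_rect (fun _ => Z) 1%Z (fun i p => (p * Z.of_nat (1 + (i + 1) * b))%Z) N).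
  assert (Hp : (0 < p)%Z) by (unfold p; clear; induction N; cbn [nat_rect]; nia).
  assert (Hdiv : forall i, i < N -> (Z.of_nat (1 + (i + 1) * b) | p)%Z).
  { unfold p. clear. induction N as [|N IH]; intros i Hi; [lia|]. cbn [nat_rect].
    destruct (Nat.eq_dec i N) as [->|]; [apply Z.divide_factor_r|].
    apply Z.divide_mul_l, IH. lia. }
  exists (Z.to_nat (a mod p)), b. intros i Hi.
  destruct (Ha i Hi) as [q Hq]. destruct (Hdiv i Hi) as [w Hw].
  assert (Hfi : f i < 1 + (i + 1) * b) by (specialize (Hf i Hi); nia).
  split; [exact Hfi|].
  pose proof (Z.mod_pos_bound a p Hp) as Hmod.
  pose proof (Z.div_mod a p ltac:(lia)) as Hdm.
  set (y := Z.of_nat (1 + (i + 1) * b)) in *.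
  assert (E : (a mod p = (q - w * (a / p)) * y + Z.of_nat (f i))%Z) by nia.
  exists (Z.to_nat (q - w * (a / p))). apply Nat2Z.inj.
  assert (0 <= q - w * (a / p))%Z by nia.
  rewrite Nat2Z.inj_add, Nat2Z.inj_mul, !Z2Nat.id by lia. exact E.
Qed.

(** Truth here means having some witness, recursive or not. For [Neg], [And] and [Ex] this depends
    only on the truth of the parts. *)
Definition definable (b : nat) (P : env -> Prop) : Prop :=
  exists D, bounded b D /\ forall e, (exists Y, witness D e Y) <-> P e.

Lemma def_iff b P Q : definable b P -> (forall e, P e <-> Q e) -> definable b Q.
Proof. intros [D [HD H]] E. exists D. split; auto. intros e. now rewrite H. Qed.

Lemma def_eq b s t :
  bounded_term b s -> bounded_term b t -> definable b (fun e => term_val e s = term_val e t).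
Proof.
  intros Hs Ht. exists (Eq s t). split; [now split|]. intros e. cbn.
  split; [now intros [_ H]|]. intros H. now exists (fun _ => False).
Qed.

Lemma def_lt b s t :
  bounded_term b s -> bounded_term b t -> definable b (fun e => term_val e s < term_val e t).
Proof.
  intros Hs Ht. exists (Lt s t). split; [now split|]. intros e. cbn.
  split; [now intros [_ H]|]. intros H. now exists (fun _ => False).
Qed.

Lemma def_not b P : definable b P -> definable b (fun e => ~ P e).
Proof.
  intros [D [HD H]]. exists (Neg D). split; [easy|]. intros e. cbn. setoid_rewrite H.
  split; [now intros [_ H']|]. intros H'. now exists (fun _ => False).
Qed.

Lemma pred_ext (X Y : nat -> Prop) : (forall k, X k <-> Y k) -> X = Y.
Proof. intros H. extensionality k. now apply propositional_extensionality. Qed.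

Lemma has_witness_and A B e :
  (exists Y, witness (And A B) e Y) <-> (exists Y, witness A e Y) /\ (exists Y, witness B e Y).
Proof.
  cbn [witness]. split.
  - intros [Y [H1 H2]]. split; eexists; eassumption.
  - intros [[Y HY] [Z HZ]].
    exists (fun k => if Nat.even k then Y (Nat.div2 k) else Z (Nat.div2 k)). split.
    + erewrite pred_ext; [exact HY|]. intros k. cbv beta.
      now rewrite Nat.even_even, Nat.div2_double.
    + erewrite pred_ext; [exact HZ|]. intros k. cbv beta.
      now rewrite Nat.even_odd, Nat.div2_odd'.
Qed.

Lemma has_witness_ex A e :
  (exists Y, witness (Ex A) e Y) <-> exists n Y, witness A (scons n e) Y.
Proof.
  cbn [witness]. split.
  - intros [Y [n [_ [_ HY]]]]. eauto.
  - intros [n [Y HY]].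
    exists (fun k => k = n \/ (n < k /\ Y (k - n - 1))), n. repeat split; auto; [lia|].
    erewrite pred_ext; [exact HY|]. intros k. cbv beta.
    replace (n + 1 + k - n - 1) with k by lia. intuition lia.
Qed.

Lemma def_and b P Q : definable b P -> definable b Q -> definable b (fun e => P e /\ Q e).
Proof.
  intros [D [HD H]] [D' [HD' H']]. exists (And D D'). split; [easy|]. intros e.
  now rewrite has_witness_and, H, H'.
Qed.

Lemma def_ex b P : definable (S b) P -> definable b (fun e => exists x, P (scons x e)).
Proof.
  intros [D [HD H]]. exists (Ex D). split; [easy|]. intros e.
  rewrite has_witness_ex. now setoid_rewrite H.
Qed.

(** A witness of [All] or [Imp] must be uniform or continuous in its input. Classical equivalents
    built from [Neg], [And] and [Ex] avoid the question of its existence, here and for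
    implication. *)
Lemma def_all b P : definable (S b) P -> definable b (fun e => forall x, P (scons x e)).
Proof.
  intros H. apply (def_iff b (fun e => ~ exists x, ~ P (scons x e))).
  - now apply def_not, (def_ex b (fun e => ~ P e)), def_not.
  - intros e. split; [|firstorder]. intros H' x. apply NNPP. eauto.
Qed.

Lemma def_imp b P Q : definable b P -> definable b Q -> definable b (fun e => P e -> Q e).
Proof.
  intros HP HQ. apply (def_iff b (fun e => ~ (P e /\ ~ Q e))).
  - now apply def_not, def_and, def_not.
  - intros e. tauto.
Qed.

Fixpoint shift_term (t : term) : term :=
  match t with
  | Var i => Var (S i)
  | Zero => Zero
  | One => One
  | Add s t => Add (shift_term s) (shift_term t)
  | Mul s t => Mul (shift_term s) (shift_term t)
  end.

Lemma term_val_shift t x e : term_val (scons x e) (shift_term t) = term_val e t.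
Proof. induction t; cbn; congruence. Qed.

Lemma bounded_shift b t : bounded_term b t -> bounded_term (S b) (shift_term t).
Proof. induction t; cbn; intuition lia. Qed.

Lemma def_beta b x y i v :
  bounded_term b x -> bounded_term b y -> bounded_term b i -> bounded_term b v ->
  definable b (fun e => beta (term_val e x) (term_val e y) (term_val e i) (term_val e v)).
Proof.
  intros Hx Hy Hi Hv.
  pose (M := Add One (Mul (Add i One) y)).
  assert (HM : bounded_term b M) by (cbn; auto).
  apply def_and; [exact (def_lt b v M Hv HM)|].
  apply (def_iff b (fun e => exists q,
    term_val (scons q e) (shift_term x) =
    term_val (scons q e) (Add (Mul (Var 0) (shift_term M)) (shift_term v)))).
  - apply (def_ex b (fun e => term_val e (shift_term x) = term_val e _)), def_eq.
    + now apply bounded_shift.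
    + split; [split; [cbn; lia|apply (bounded_shift b M HM)]|now apply bounded_shift].
  - intros e.
    enough (E : forall q, term_val (scons q e) (Add (Mul (Var 0) (shift_term M)) (shift_term v)) =
      q * term_val e M + term_val e v).
    { setoid_rewrite E. setoid_rewrite term_val_shift. reflexivity. }
    intros q. rewrite <- (term_val_shift M q e), <- (term_val_shift v q e). reflexivity.
Qed.

(** The values of the recursion up to [h] form a finite table, which β codes by two numbers; the
    recursion becomes a condition on adjacent entries. *)
Lemma nat_rect_beta (f v : nat) (g : nat -> nat -> nat) h :
  v = nat_rect (fun _ => nat) f g h <->
  exists a b, beta a b 0 f /\ beta a b h v /\
    forall i, i < h -> exists u, beta a b i u /\ beta a b (i + 1) (g i u).
Proof.
  split.
  - intros ->. destruct (beta_exists (nat_rect (fun _ => nat) f g) (S h)) as [a [b H]].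
    exists a, b. split; [apply (H 0); lia|]. split; [apply H; lia|].
    intros i Hi. eexists. split; [apply H; lia|].
    specialize (H (S i)). rewrite Nat.add_1_r. apply H. lia.
  - intros [a [b [H0 [Hh H]]]].
    enough (Hi : forall i, i <= h -> beta a b i (nat_rect (fun _ => nat) f g i))
      by (eapply beta_fun; eauto).
    induction i as [|i IH]; intros Hi; [exact H0|].
    destruct (H i Hi) as [u [Hu Hg]]. rewrite Nat.add_1_r in Hg.
    rewrite (beta_fun _ _ _ _ _ Hu (IH ltac:(lia))) in Hg. exact Hg.
Qed.

(** The induction places graphs under fresh quantifiers, which shifts all variables. Hence the
    output index [o] and the renaming [r] of the inputs are arbitrary. *)
Lemma def_PR k F :
  PR no_base k F -> forall b o (r : nat -> nat), o < b -> (forall i, i < k -> r i < b) ->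
  definable b (fun e => e o = F (fun i => e (r i))).
Proof.
  induction 1 as [k i Hi|k|k F _ IH|k f F Hf _ IH|k F G _ IHG HF IHF
    |m k r F _ IH Hr|k F G H HF IHF HG IHG HH IHH|k F G _ IH E]; intros b o ρ Ho Hρ.
  - apply (def_eq b (Var o) (Var (ρ i))); cbn; auto.
  - apply (def_eq b (Var o) Zero); cbn; auto.
  - apply (def_iff b (fun e => exists x, x = F (fun i => e (ρ i)) /\ e o = x + 1)).
    + apply (def_ex b (fun e => e 0 = F (fun i => e (S (ρ i))) /\ e (S o) = e 0 + 1)), def_and.
      * apply IH; [lia|]. intros i Hi. now apply -> Nat.succ_lt_mono; apply Hρ.
      * apply (def_eq (S b) (Var (S o)) (Add (Var 0) One)); cbn; repeat split; lia.
    + intros e. split; [intros [x [-> ->]]; lia|]. intros ->. eexists. split; [reflexivity|lia].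
  - destruct Hf.
  - apply (def_iff b (fun e => exists x, x = G (fun i => e (ρ i)) /\ 
      e o = F (fun i => scons x e (scons 0 (fun i => S (ρ i)) i)))).
    + apply (def_ex b (fun e => e 0 = G (fun i => e (S (ρ i))) /\
        e (S o) = F (fun i => e (scons 0 (fun i => S (ρ i)) i)))), def_and.
      * apply IHG; [lia|]. intros i Hi. now apply -> Nat.succ_lt_mono; apply Hρ.
      * apply IHF; [lia|]. intros [|i] Hi; cbn; [lia|]. apply -> Nat.succ_lt_mono. apply Hρ. lia.
    + intros e.
      assert (E : forall x, F (fun i => scons x e (scons 0 (fun i => S (ρ i)) i)) =
        F (scons x (fun i => e (ρ i)))) by (intros x; apply (PR_local _ _ _ HF); now intros [|i]).
      split; [intros [x [-> ->]]; apply E|]. intros ->. eexists. split; [reflexivity|]. now rewrite E.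
  - apply (IH b o (fun i => ρ (r i)) Ho). auto.
  - assert (Sb : forall i c, i < b -> c + i < c + b) by lia.
    (* [x] and [y] code the table. Below the seven binders [h], [f], [x], [y], [i], [u], [w], the
       step function finds its counter at index 2, the previous value at 1 and old variables at
       [7 + ρ j]. The quantifiers are then peeled off one by one. *)
    apply (def_iff b (fun e => exists h f x y, 
      (f = F (fun i => e (ρ i)) /\ h = H (fun i => e (ρ i))) /\
      beta x y 0 f /\ beta x y h (e o) /\
      forall i, i < h -> exists u w, beta x y i u /\ beta x y (i + 1) w /\
        w = G (fun j => scons w (scons u (scons i (scons y (scons x (scons f (scons h e))))))
                 (match j with 0 => 2 | 1 => 1 | S (S j) => 7 + ρ j end)))).
    + apply (def_ex b (fun e => exists f x y, 
        (f = F (fun i => e (1 + ρ i)) /\ e 0 = H (fun i => e (1 + ρ i))) /\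
        beta x y 0 f /\ beta x y (e 0) (e (1 + o)) /\
        forall i, i < e 0 -> exists u w, beta x y i u /\ beta x y (i + 1) w /\
        w = G (fun j => scons w (scons u (scons i (scons y (scons x (scons f e)))))
                 (match j with 0 => 2 | 1 => 1 | S (S j) => 7 + ρ j end)))).
      apply (def_ex (1 + b) (fun e => exists x y, 
        (e 0 = F (fun i => e (2 + ρ i)) /\ e 1 = H (fun i => e (2 + ρ i))) /\
        beta x y 0 (e 0) /\ beta x y (e 1) (e (2 + o)) /\
        forall i, i < e 1 -> exists u w, beta x y i u /\ beta x y (i + 1) w /\
        w = G (fun j => scons w (scons u (scons i (scons y (scons x e))))
                 (match j with 0 => 2 | 1 => 1 | S (S j) => 7 + ρ j end)))).
      apply (def_ex (2 + b) (fun e => exists y, 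
        (e 1 = F (fun i => e (3 + ρ i)) /\ e 2 = H (fun i => e (3 + ρ i))) /\
        beta (e 0) y 0 (e 1) /\ beta (e 0) y (e 2) (e (3 + o)) /\
        forall i, i < e 2 -> exists u w, beta (e 0) y i u /\ beta (e 0) y (i + 1) w /\
        w = G (fun j => scons w (scons u (scons i (scons y e)))
                 (match j with 0 => 2 | 1 => 1 | S (S j) => 7 + ρ j end)))).
      apply (def_ex (3 + b) (fun e =>
        (e 2 = F (fun i => e (4 + ρ i)) /\ e 3 = H (fun i => e (4 + ρ i))) /\
        beta (e 1) (e 0) 0 (e 2) /\ beta (e 1) (e 0) (e 3) (e (4 + o)) /\
        forall i, i < e 3 -> exists u w, beta (e 1) (e 0) i u /\ beta (e 1) (e 0) (i + 1) w /\
        w = G (fun j => scons w (scons u (scons i e))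
                 (match j with 0 => 2 | 1 => 1 | S (S j) => 7 + ρ j end)))).
      apply def_and; [apply def_and|apply def_and; [|apply def_and]].
      * apply IHF; [lia|]. intros i Hi. now apply Sb with (c := 4); apply Hρ.
      * apply IHH; [lia|]. intros i Hi. now apply Sb with (c := 4); apply Hρ.
      * apply (def_beta (4 + b) (Var 1) (Var 0) Zero (Var 2)); cbn; lia.
      * apply (def_beta (4 + b) (Var 1) (Var 0) (Var 3) (Var (4 + o))); cbn; lia.
      * apply (def_all (4 + b) (fun e => e 0 < e 4 -> exists u w,
          beta (e 2) (e 1) (e 0) u /\ beta (e 2) (e 1) (e 0 + 1) w /\
          w = G (fun j => scons w (scons u e)
                 (match j with 0 => 2 | 1 => 1 | S (S j) => 7 + ρ j end)))).
        apply def_imp; [apply (def_lt (5 + b) (Var 0) (Var 4)); cbn; lia|].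
        apply (def_ex (5 + b) (fun e => exists w,
          beta (e 3) (e 2) (e 1) (e 0) /\ beta (e 3) (e 2) (e 1 + 1) w /\
          w = G (fun j => scons w e
                 (match j with 0 => 2 | 1 => 1 | S (S j) => 7 + ρ j end)))).
        apply (def_ex (6 + b) (fun e => 
          beta (e 4) (e 3) (e 2) (e 1) /\ beta (e 4) (e 3) (e 2 + 1) (e 0) /\
          e 0 = G (fun j => e
                 (match j with 0 => 2 | 1 => 1 | S (S j) => 7 + ρ j end)))).
        apply def_and; [|apply def_and].
        -- apply (def_beta (7 + b) (Var 4) (Var 3) (Var 2) (Var 1)); cbn; lia.
        -- apply (def_beta (7 + b) (Var 4) (Var 3) (Add (Var 2) One) (Var 0)); cbn; lia.
        -- apply (IHG (7 + b) 0 (fun j => match j with 0 => 2 | 1 => 1 | S (S j) => 7 + ρ j end));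
             [lia|]. intros [|[|j]] Hj; try lia. apply Sb with (c := 7), Hρ. lia.
    + intros e. rewrite nat_rect_beta.
      assert (E : forall h f x y i u w,
        G (fun j => scons w (scons u (scons i (scons y (scons x (scons f (scons h e))))))
                 (match j with 0 => 2 | 1 => 1 | S (S j) => 7 + ρ j end)) =
        G (scons i (scons u (fun i => e (ρ i))))).
      { intros. apply (PR_local _ _ _ HG). now intros [|[|j]]. }
      split.
      * intros [h [f [x [y [[-> ->] [H0 [Hh Hi]]]]]]]. exists x, y. split; [exact H0|]. split; [exact Hh|].
        intros i Hl. destruct (Hi i Hl) as [u [w [H1 [H2 H3]]]]. exists u. rewrite E in H3.
        subst w. auto.
      * intros [x [y [H0 [Hh Hi]]]]. eexists _, _, x, y. split; [split; reflexivity|].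
        split; [exact H0|]. split; [exact Hh|]. intros i Hl. destruct (Hi i Hl) as [u [H1 H2]].
        exists u. eexists. rewrite E. eauto.
  - apply (def_iff b (fun e => e o = F (fun i => e (ρ i)))); [now apply IH|].
    intros e. now rewrite E.
Qed.

Lemma def_PR_ex k (f : env -> bool) :
  PR no_base (S k) (fun e => Nat.b2n (f e)) -> definable k (fun e => exists x, f (scons x e) = true).
Proof.
  intros Hf. apply (def_ex k (fun e => f e = true)).
  apply (def_iff (S k) (fun e => exists v, v = Nat.b2n (f e) /\ v = 1)).
  - apply (def_ex (S k) (fun e => e 0 = Nat.b2n (f (fun i => e (S i))) /\ e 0 = 1)), def_and.
    + apply (def_PR (S k) (fun e => Nat.b2n (f e)) Hf (S (S k)) 0 S); lia.
    + apply (def_eq (S (S k)) (Var 0) One); cbn; lia.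
  - intros e. destruct (f e); cbn; split; [auto| |intros [v [-> H]]; easy|easy].
    intros _. now exists 1.
Qed.

(** * A universal machine *)

Fixpoint prog_code (p : prog) : nat :=
  match p with
  | PZero => npair 0 0
  | PSucc => npair 1 0
  | PProj i => npair 2 i
  | PComp f gs =>
      npair 3 (npair (prog_code f) (fold_right (fun g c => S (npair (prog_code g) c)) 0 gs))
  | PRec f g => npair 4 (npair (prog_code f) (prog_code g))
  | PMu f => npair 5 (prog_code f)
  end.

Definition progs_code (gs : list prog) : nat :=
  fold_right (fun g c => S (npair (prog_code g) c)) 0 gs.

Definition list_code (l : list nat) : nat := fold_right npair 0 l.

(* Configurations of an abstract machine evaluating programs: a mode (return a value,
   evaluate a program, evaluate a list of programs), its operands, and a stack of frames. *)
Definition quad (t a b k : nat) : nat := npair t (npair a (npair b k)).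
Definition rest (c : nat) : nat := snd_of (snd_of (snd_of c)).
Definition push (f k : nat) : nat := S (npair f k).
Definition ret_cfg (v k : nat) : nat := quad 0 v 0 k.
Definition eval_cfg (p l k : nat) : nat := quad 1 p l k.
Definition evals_cfg (gs l k : nat) : nat := quad 2 gs l k.

(** Each frame says what awaits a result: run [f] on the argument list; evaluate the remaining
    programs; prepend a computed value; take the next recursion step; test a value in a
    minimization. *)
Definition app_frame (f : nat) : nat := quad 0 f 0 0.
Definition args_frame (gs l : nat) : nat := quad 1 gs l 0.
Definition cons_frame (w : nat) : nat := quad 2 w 0 0.
Definition rec_frame (g n l : nat) : nat := quad 3 g n l.
Definition mu_frame (f n l : nat) : nat := quad 4 f n l.

Definition step_frame (v f k : nat) : nat :=
  if get f 0 =? 0 then eval_cfg (get f 1) v k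
  else if get f 0 =? 1 then evals_cfg (get f 1) (get f 2) (push (cons_frame v) k)
  else if get f 0 =? 2 then ret_cfg (npair (get f 1) v) k
  else if get f 0 =? 3 then eval_cfg (get f 1) (npair (get f 2) (npair v (rest f))) k
  else if v =? 0 then ret_cfg (get f 2) k
  else eval_cfg (get f 1) (npair (S (get f 2)) (rest f))
         (push (mu_frame (get f 1) (S (get f 2)) (rest f)) k).

Definition step_eval (p l k : nat) : nat :=
  if fst_of p =? 0 then ret_cfg 0 k
  else if fst_of p =? 1 then ret_cfg (S (fst_of l)) k
  else if fst_of p =? 2 then ret_cfg (get l (snd_of p)) k
  else if fst_of p =? 3 then
    evals_cfg (snd_of (snd_of p)) l (push (app_frame (get p 1)) k)
  else if fst_of p =? 4 then
    if fst_of l =? 0 then eval_cfg (get p 1) (snd_of l) k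
    else eval_cfg p (npair (pred (fst_of l)) (snd_of l))
           (push (rec_frame (snd_of (snd_of p)) (pred (fst_of l)) (snd_of l)) k)
  else eval_cfg (snd_of p) (npair 0 l) (push (mu_frame (snd_of p) 0 l) k).

Definition step_evals (gs l k : nat) : nat :=
  if gs =? 0 then ret_cfg 0 k
  else eval_cfg (fst_of (pred gs)) l (push (args_frame (snd_of (pred gs)) l) k).

Definition step (c : nat) : nat :=
  if get c 0 =? 0 then
    if rest c =? 0 then c else step_frame (get c 1) (fst_of (pred (rest c))) (snd_of (pred (rest c)))
  else if get c 0 =? 1 then step_eval (get c 1) (get c 2) (rest c)
  else step_evals (get c 1) (get c 2) (rest c).

Lemma pr_rest : pr1 rest.
Proof. intros B. unfold rest. pr. Qed.
#[local] Hint Resolve pr_rest : pr.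

Lemma pr_step_frame : pr3 step_frame.
Proof.
  intros B. unfold step_frame, eval_cfg, evals_cfg, ret_cfg, push, mu_frame, cons_frame, quad. pr.
Qed.

Lemma pr_step_eval : pr3 step_eval.
Proof.
  intros B. unfold step_eval, eval_cfg, evals_cfg, ret_cfg, push, mu_frame, app_frame, rec_frame, quad. pr.
Qed.

Lemma pr_step_evals : pr3 step_evals.
Proof.
  intros B. unfold step_evals, eval_cfg, ret_cfg, push, args_frame, quad. pr.
Qed.
#[local] Hint Resolve pr_step_frame pr_step_eval pr_step_evals : pr.

Lemma pr_step : pr1 step.
Proof. intros B. unfold step. pr. Qed.
#[local] Hint Resolve pr_step : pr.

Definition result (c : nat) : nat :=
  if (get c 0 =? 0) && (rest c =? 0) then S (get c 1) else 0.

Lemma pr_result : pr1 result.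
Proof. intros B. unfold result. pr. Qed.
#[local] Hint Resolve pr_result : pr.

Lemma result_step c z : result c = S z -> step c = c.
Proof. unfold result, step. now destruct (get c 0 =? 0), (rest c =? 0). Qed.

(* [stage e k] is [S z] if program [e], run on input [e], has returned [z] after [k] steps. *)
Definition stage (e k : nat) : nat :=
  result (Nat.iter k step (eval_cfg e (npair e 0) 0)).

Lemma pr_stage : pr2 stage.
Proof.
  intros B. unfold stage, eval_cfg, quad.
  apply (pr_app1 B 2 result
    (fun e => Nat.iter (e 1) step (npair 1 (npair (e 0) (npair (npair (e 0) 0) 0))))); [pr|].
  apply pr_nat_iter with (f := fun _ => step); pr.
Qed.
#[local] Hint Resolve pr_stage : pr.

Lemma stage_mono e k k' z : stage e k = S z -> k <= k' -> stage e k' = S z.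
Proof.
  intros H L. induction L as [|k' L IH]; [exact H|]. clear H.
  unfold stage in *. change (Nat.iter (S k') step ?c) with (step (Nat.iter k' step c)).
  now rewrite (result_step _ _ IH).
Qed.

Lemma stage_fun e k k' z z' : stage e k = S z -> stage e k' = S z' -> z = z'.
Proof.
  intros H H'. apply (stage_mono e k (max k k')) in H; [|lia].
  apply (stage_mono e k' (max k k')) in H'; [|lia]. congruence.
Qed.

Definition reach (c c' : nat) : Prop := exists k, Nat.iter k step c = c'.

Lemma reach_refl c : reach c c.
Proof. now exists 0. Qed.

Lemma reach_step c c' c'' : step c = c' -> reach c' c'' -> reach c c''.
Proof. intros <- [k Hk]. exists (S k). now rewrite Nat.iter_succ_r. Qed.

Lemma reach_trans c c' c'' : reach c c' -> reach c' c'' -> reach c c''.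
Proof. intros [k <-] [k' <-]. exists (k' + k). now rewrite Nat.iter_add. Qed.

Lemma get_quad t a b k :
  get (quad t a b k) 0 = t /\ get (quad t a b k) 1 = a /\ get (quad t a b k) 2 = b /\
  rest (quad t a b k) = k.
Proof.
  unfold quad, rest. rewrite !get_npair_S, !get_npair_0, !snd_of_npair. auto.
Qed.

Lemma step_push v f k : step (ret_cfg v (push f k)) = step_frame v f k.
Proof.
  unfold step, ret_cfg, push. destruct (get_quad 0 v 0 (S (npair f k))) as (-> & -> & _ & ->).
  cbn [Nat.eqb pred]. now rewrite fst_of_npair, snd_of_npair.
Qed.

Lemma step_eval_cfg p l k : step (eval_cfg p l k) = step_eval p l k.
Proof. unfold step, eval_cfg. now destruct (get_quad 1 p l k) as (-> & -> & -> & ->). Qed.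

Lemma step_evals_cfg gs l k : step (evals_cfg gs l k) = step_evals gs l k.
Proof. unfold step, evals_cfg. now destruct (get_quad 2 gs l k) as (-> & -> & -> & ->). Qed.

Lemma get_list_code l i v : nth_error l i = Some v -> get (list_code l) i = v.
Proof.
  revert i. induction l as [|a l IH]; intros [|i] H; try easy; cbn in H;
    change (list_code (a :: l)) with (npair a (list_code l)).
  - injection H as ->. apply get_npair_0.
  - rewrite get_npair_S. auto.
Qed.

Ltac pairs := repeat
  (rewrite get_npair_S || rewrite get_npair_0 || rewrite fst_of_npair || rewrite snd_of_npair).

Ltac machine :=
  eapply reach_step;
  [ first [ rewrite step_push; unfold step_frame, app_frame, args_frame, cons_frame, rec_frame,
              mu_frame, rest, quad
          | rewrite step_eval_cfg; unfold step_eval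
          | rewrite step_evals_cfg; unfold step_evals ];
    cbn [prog_code progs_code list_code fold_right]; pairs; cbn [Nat.eqb pred]; pairs;
    cbn [Nat.eqb pred]; pairs; reflexivity
  | ].

Scheme eval_mind := Minimality for eval Sort Prop
  with evals_mind := Minimality for evals Sort Prop.
Combined Scheme eval_evals_ind from eval_mind, evals_mind.

(** Simulation for an arbitrary stack [k], by induction on the derivation. The machine may also halt
    where [eval] is undefined, for instance on tuples of a wrong length; this is harmless, as
    [returns] is defined from the machine. *)
Lemma machine_eval :
  (forall p l v, eval p l v ->
     forall k, reach (eval_cfg (prog_code p) (list_code l) k) (ret_cfg v k)) /\
  (forall gs l ws, evals gs l ws ->
     forall k, reach (evals_cfg (progs_code gs) (list_code l) k) (ret_cfg (list_code ws) k)).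
Proof.
  apply eval_evals_ind.
  - intros l k. machine. apply reach_refl.
  - intros n k. machine. apply reach_refl.
  - intros i l v H k. machine. rewrite (get_list_code _ _ _ H). apply reach_refl.
  - intros f gs l ws v _ IHgs _ IHf k. machine.
    eapply reach_trans; [apply IHgs|]. machine. apply IHf.
  - intros f g l v _ IH k. machine. apply IH.
  - intros f g n l u v _ IHn _ IHg k. machine.
    eapply reach_trans; [apply IHn|]. machine. apply IHg.
  - intros f l n w Hw IHw _ IHn k. machine.
    (* The search is followed backwards from its successful trial: [i] is the distance to [n]. *)
    enough (H : forall i, i <= n ->
      reach (eval_cfg (prog_code f) (npair (n - i) (list_code l))
               (push (mu_frame (prog_code f) (n - i) (list_code l)) k)) (ret_cfg n k)).
    { specialize (H n). rewrite Nat.sub_diag in H. apply H. lia. }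
    induction i as [|i IH]; intros Hi.
    + rewrite Nat.sub_0_r. eapply reach_trans; [apply IHn|]. machine. apply reach_refl.
    + eapply reach_trans; [apply (IHw (n - S i)); lia|]. machine.
      replace (S (n - S i)) with (n - i) by lia. apply IH. lia.
  - intros l k. machine. apply reach_refl.
  - intros g gs l w ws _ IHg _ IHgs k. machine.
    eapply reach_trans; [apply IHg|]. machine.
    eapply reach_trans; [apply IHgs|]. machine. apply reach_refl.
Qed.

Lemma stage_universal g : recursive_function g -> exists e k, stage e k = S (g e).
Proof.
  intros [p Hp]. exists (prog_code p).
  destruct (proj1 machine_eval _ _ _ (Hp (prog_code p)) 0) as [k Hk]. exists k.
  unfold stage. cbn [list_code fold_right] in Hk. rewrite Hk. unfold result, ret_cfg.
  now destruct (get_quad 0 (g (prog_code p)) 0 0) as (-> & -> & _ & ->).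
Qed.

(** * A tree normal form for Sigma^1_1 sets *)

(** A classically complete fragment, so that fewer kinds of constraints are needed below. *)
Inductive sform : Type :=
| SEq : term -> term -> sform
| SLt : term -> term -> sform
| SMem : term -> nat -> sform
| SNeg : sform -> sform
| SOr : sform -> sform -> sform
| SEx : sform -> sform.

Fixpoint ssat (X : nat -> nat -> Prop) (e : env) (A : sform) : Prop :=
  match A with
  | SEq s t => term_val e s = term_val e t
  | SLt s t => term_val e s < term_val e t
  | SMem t i => X i (term_val e t)
  | SNeg A => ~ ssat X e A
  | SOr A B => ssat X e A \/ ssat X e B
  | SEx A => exists n, ssat X (scons n e) A
  end.

Fixpoint simplify (A : form2) : sform :=
  match A with
  | Eq2 s t => SEq s t
  | Lt2 s t => SLt s t
  | Mem2 t i => SMem t i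
  | Neg2 A => SNeg (simplify A)
  | And2 A B => SNeg (SOr (SNeg (simplify A)) (SNeg (simplify B)))
  | Or2 A B => SOr (simplify A) (simplify B)
  | Imp2 A B => SOr (SNeg (simplify A)) (simplify B)
  | Ex2 A => SEx (simplify A)
  | All2 A => SNeg (SEx (SNeg (simplify A)))
  end.

Lemma ssat_simplify X A : forall e, ssat X e (simplify A) <-> sat2 X e A.
Proof.
  induction A as [| | |A IH|A IHA B IHB|A IHA B IHB|A IHA B IHB|A IH|A IH]; intros e; cbn;
    rewrite ?IHA, ?IHB; try setoid_rewrite IH; try tauto.
  split; [|firstorder]. intros H n. apply NNPP. eauto.
Qed.

(* The tags start at 1, so that codes of formulas differ from all [npair 0 i]. *)
Fixpoint scode (A : sform) : nat :=
  match A with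
  | SEq s t => npair 1 (npair (term_code s) (term_code t))
  | SLt s t => npair 2 (npair (term_code s) (term_code t))
  | SMem t i => npair 3 (npair (term_code t) i)
  | SNeg A => npair 4 (scode A)
  | SOr A B => npair 5 (npair (scode A) (scode B))
  | SEx A => npair 6 (scode A)
  end.

Ltac npair_inj := repeat match goal with
  | H : npair _ _ = npair _ _ |- _ => apply npair_inj in H; destruct H
  end; try discriminate.

Lemma term_code_inj s : forall t, term_code s = term_code t -> s = t.
Proof. induction s; intros []; cbn [term_code]; intros; npair_inj; f_equal; auto. Qed.

Lemma scode_inj A : forall B, scode A = scode B -> A = B.
Proof.
  induction A; intros []; cbn [scode]; intros; npair_inj; f_equal; auto using term_code_inj.
Qed.

Lemma scode_not_npair_0 A i : scode A <> npair 0 i.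
Proof. destruct A; cbn [scode]; intros H; npair_inj. Qed.

Definition implies (a b : bool) : bool := if a then b else true.

Lemma implies_spec a b : implies a b = true <-> (a = true -> b = true).
Proof. destruct a, b; cbn; intuition. Qed.

(* Constraints between the values [y] and [z] at positions [j] and [k] of a sequence
   encoding sets ([X_i] contains [t] iff the value at [<<0,i>,t>] is positive) and the
   satisfaction relation for [A] and its subformulas (under the assignment [get c], [A] is
   true iff the value at [<scode A, c>] is positive), where the value also tells which disjunct
   or which instance is true. *)
Fixpoint constr (A : sform) (j y k z : nat) : bool :=
  match A with
  | SEq s t =>
      implies (fst_of j =? scode A)
        (if term_val (get (snd_of j)) s =? term_val (get (snd_of j)) t
         then negb (y =? 0) else y =? 0)
  | SLt s t =>
      implies (fst_of j =? scode A)
        (if term_val (get (snd_of j)) s <? term_val (get (snd_of j)) t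
         then negb (y =? 0) else y =? 0)
  | SMem t i =>
      implies ((fst_of j =? scode A) && (k =? npair (npair 0 i) (term_val (get (snd_of j)) t)))
        (if z =? 0 then y =? 0 else negb (y =? 0))
  | SNeg B => constr B j y k z &&
      implies ((fst_of j =? scode A) && (k =? npair (scode B) (snd_of j)))
        (if z =? 0 then negb (y =? 0) else y =? 0)
  | SOr B C => constr B j y k z && constr C j y k z &&
      implies ((fst_of j =? scode A) && (k =? npair (scode B) (snd_of j)))
        (if y =? 0 then z =? 0 else implies (y =? 1) (negb (z =? 0))) &&
      implies ((fst_of j =? scode A) && (k =? npair (scode C) (snd_of j)))
        (if y =? 0 then z =? 0 else implies (negb (y =? 1)) (negb (z =? 0)))
  | SEx B => constr B j y k z &&
      implies ((fst_of j =? scode A) && ((fst_of k =? scode B) && (snd_of (snd_of k) =? snd_of j)))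
        (if y =? 0 then z =? 0 else implies (pred y =? fst_of (snd_of k)) (negb (z =? 0)))
  end.

Lemma pr_term_val B k t c : PR B k c -> PR B k (fun e => term_val (get (c e)) t).
Proof. intros Hc. induction t; cbn [term_val]; pr; auto. Qed.

Lemma pr_implies B k a b :
  PR B k (fun e => Nat.b2n (a e)) -> PR B k (fun e => Nat.b2n (b e)) ->
  PR B k (fun e => Nat.b2n (implies (a e) (b e))).
Proof. intros Ha Hb. unfold implies. pr; assumption. Qed.

#[local] Hint Extern 0 (PR _ _ (fun e => term_val (get (@?c e)) ?t)) =>
  apply (pr_term_val _ _ t c); pr : pr_goal.
#[local] Hint Extern 0 (PR _ _ (fun e => Nat.b2n (implies (@?a e) (@?b e)))) =>
  apply (pr_implies _ _ a b); pr : pr_goal.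

Lemma pr_constr B A :
  PR B 4 (fun e => Nat.b2n (constr A (e 0) (e 1) (e 2) (e 3))).
Proof. induction A; cbn [constr]; pr. Qed.

#[local] Hint Extern 0 (PR _ _ (fun e => Nat.b2n (constr ?A (@?a e) (@?b e) (@?c e) (@?d e)))) =>
  apply (pr_app4 _ _ (fun j y k z => Nat.b2n (constr A j y k z)) a b c d);
  [apply pr_constr|pr|pr|pr|pr] : pr_goal.

Lemma get_npair a c : get (npair a c) = scons a (get c).
Proof. extensionality i. destruct i; [apply get_npair_0|apply get_npair_S]. Qed.

Lemma get_0 : get 0 = fun _ => 0.
Proof.
  extensionality i. induction i as [|i IH]; [reflexivity|].
  change 0 with (npair 0 0) at 1. now rewrite get_npair_S.
Qed.

Lemma eqb_case (v : nat) (b : bool) :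
  (if b then negb (v =? 0) else v =? 0) = true <-> (0 < v <-> b = true).
Proof.
  assert (E : 0 < v <-> (v =? 0) = false) by (rewrite Nat.eqb_neq; lia).
  rewrite E. destruct b, (v =? 0); cbn; intuition congruence.
Qed.

Lemma zero_case (v : nat) (a b : bool) :
  (if v =? 0 then a else b) = true <-> (v = 0 -> a = true) /\ (0 < v -> b = true).
Proof.
  destruct v; cbn; split; [intros H; split; intros; easy || lia|intros [H _]; auto
    |intros H; split; intros; easy || lia|intros [_ H]; auto with arith].
Qed.

Lemma negb_zero v : negb (v =? 0) = true <-> 0 < v.
Proof. rewrite Bool.negb_true_iff, Nat.eqb_neq. lia. Qed.

Lemma negb_one v : negb (v =? 1) = true <-> v <> 1.
Proof. now rewrite Bool.negb_true_iff, Nat.eqb_neq. Qed.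

(** The constraints are Tarski's truth clauses with Skolem values, so positivity agrees with
    satisfaction by induction on [A]. Each of them relates only two positions, which makes their
    conjunction a closed condition on [G]. *)
Lemma constr_sound G A :
  (forall j k, constr A j (G j) k (G k) = true) ->
  forall c, 0 < G (npair (scode A) c) <->
    ssat (fun i t => 0 < G (npair (npair 0 i) t)) (get c) A.
Proof.
  induction A as [s t|s t|t i|A IH|A IHA B IHB|A IH]; intros H c; cbn [constr ssat] in *;
    repeat setoid_rewrite Bool.andb_true_iff in H; repeat setoid_rewrite implies_spec in H;
    repeat setoid_rewrite Bool.andb_true_iff in H;
    repeat setoid_rewrite eqb_case in H; repeat setoid_rewrite zero_case in H;
    repeat setoid_rewrite negb_zero in H; repeat setoid_rewrite implies_spec in H;
    repeat setoid_rewrite negb_zero in H; repeat setoid_rewrite negb_one in H;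
    repeat setoid_rewrite Nat.eqb_eq in H; repeat setoid_rewrite Nat.ltb_lt in H.
  - specialize (H (npair (scode (SEq s t)) c) 0). rewrite fst_of_npair, snd_of_npair in H. auto.
  - specialize (H (npair (scode (SLt s t)) c) 0). rewrite fst_of_npair, snd_of_npair in H. auto.
  - specialize (H (npair (scode (SMem t i)) c) (npair (npair 0 i) (term_val (get c) t))).
    rewrite fst_of_npair, snd_of_npair in H. specialize (H (conj eq_refl eq_refl)). lia.
  - rewrite <- IH by (intros; apply H).
    destruct (H (npair (scode (SNeg A)) c) (npair (scode A) c)) as [_ H'].
    rewrite fst_of_npair, snd_of_npair in H'. specialize (H' (conj eq_refl eq_refl)). lia.
  - rewrite <- IHA, <- IHB by (intros; apply H).
    destruct (H (npair (scode (SOr A B)) c) (npair (scode A) c)) as [[_ HA] _].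
    destruct (H (npair (scode (SOr A B)) c) (npair (scode B) c)) as [_ HB].
    rewrite fst_of_npair, snd_of_npair in HA, HB.
    specialize (HA (conj eq_refl eq_refl)). specialize (HB (conj eq_refl eq_refl)). lia.
  - setoid_rewrite <- get_npair. setoid_rewrite <- IH; [|intros; apply H].
    assert (H' : forall m, _) by exact (fun m => proj2 (H (npair (scode (SEx A)) c) (npair (scode A) (npair m c)))).
    setoid_rewrite fst_of_npair in H'. setoid_rewrite snd_of_npair in H'.
    setoid_rewrite fst_of_npair in H'. setoid_rewrite snd_of_npair in H'.
    split.
    + intros Hv. exists (pred (G (npair (scode (SEx A)) c))).
      specialize (H' (pred (G (npair (scode (SEx A)) c))) (conj eq_refl (conj eq_refl eq_refl))). lia.
    + intros [m Hm]. specialize (H' m (conj eq_refl (conj eq_refl eq_refl))). lia.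
Qed.

(** The intended values: at a disjunction, 1 points to the left disjunct and anything larger to the
    right one; at an existential formula, [S m] points to the instance [m]. *)
Definition good (X : nat -> nat -> Prop) (A : sform) (e : env) (v : nat) : Prop :=
  match A with
  | SOr B C =>
      match v with
      | 0 => ~ ssat X e (SOr B C)
      | 1 => ssat X e B
      | _ => ssat X e C
      end
  | SEx B =>
      match v with
      | 0 => ~ ssat X e (SEx B)
      | S m => ssat X (scons m e) B
      end
  | _ => 0 < v <-> ssat X e A
  end.

Lemma good_sat X A e v : good X A e v -> 0 < v <-> ssat X e A.
Proof.
  destruct A; cbn; auto; [destruct v as [|[|]]|destruct v]; intros H; split;
    intros; try lia; try tauto; eauto; easy.
Qed.

Lemma good_exists X A e : exists v, good X A e v.
Proof.
  destruct (classic (ssat X e A)) as [H|H].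
  - destruct A as [s t|s t|t i|A|A B|A]; cbn in H; try (exists 1; cbn; intuition lia; fail).
    + destruct H; [now exists 1|now exists 2].
    + destruct H as [m Hm]. now exists (S m).
  - exists 0. destruct A; cbn; auto; intuition lia.
Qed.

Lemma constr_complete X :
  exists G, (forall i t, 0 < G (npair (npair 0 i) t) <-> X i t) /\
    forall A j k, constr A j (G j) k (G k) = true.
Proof.
  destruct (functional_choice (fun p v =>
    (forall A, scode A = fst_of p -> good X A (get (snd_of p)) v) /\
    (forall i, fst_of p = npair 0 i -> 0 < v <-> X i (snd_of p)))) as [G HG].
  (* Positions holding a formula code and positions holding some [npair 0 i] are disjoint, so values
     can be chosen separately; all other positions get 0. *)
  { intros p. destruct (classic (exists A, scode A = fst_of p)) as [[A HA]|HA].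
    - destruct (good_exists X A (get (snd_of p))) as [v Hv]. exists v. split.
      + intros A' E. rewrite <- HA in E. now apply scode_inj in E as ->.
      + intros i E. rewrite <- HA in E. now apply scode_not_npair_0 in E.
    - destruct (classic (exists i, fst_of p = npair 0 i /\ X i (snd_of p))) as [[i [Hi HX]]|HX].
      + exists 1. split; [intros A E; exfalso; eauto|].
        intros i' E. rewrite Hi in E. apply npair_inj in E as [_ <-]. intuition.
      + exists 0. split; [intros A E; exfalso; eauto|].
        intros i E. split; [lia|]. intros HX'. exfalso. eauto. }
  assert (HG1 : forall A c, good X A (get c) (G (npair (scode A) c))).
  { intros A c. pose proof (proj1 (HG (npair (scode A) c)) A) as H.
    rewrite fst_of_npair, snd_of_npair in H. auto. }
  assert (HG2 : forall i t, 0 < G (npair (npair 0 i) t) <-> X i t).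
  { intros i t. pose proof (proj2 (HG (npair (npair 0 i) t)) i) as H.
    rewrite fst_of_npair, snd_of_npair in H. auto. }
  exists G. split; [exact HG2|]. intros A j k. rewrite <- (npair_of j).
  generalize (fst_of j), (snd_of j). intros a c.
  induction A as [s t|s t|t i|A IH|A IHA B IHB|A IH]; cbn [constr];
    rewrite ?Bool.andb_true_iff, ?implies_spec, ?Bool.andb_true_iff, ?fst_of_npair, ?snd_of_npair,
      ?Nat.eqb_eq.
  - intros ->. apply eqb_case. rewrite Nat.eqb_eq. exact (HG1 (SEq s t) c).
  - intros ->. apply eqb_case. rewrite Nat.ltb_lt. exact (HG1 (SLt s t) c).
  - intros [-> ->]. pose proof (HG1 (SMem t i) c) as H. cbn [good ssat] in H.
    rewrite <- HG2 in H. rewrite zero_case, Nat.eqb_eq, negb_zero. lia.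
  - split; [exact IH|]. intros [-> ->]. pose proof (HG1 (SNeg A) c) as H. cbn [good ssat] in H.
    rewrite <- (good_sat _ _ _ _ (HG1 A c)) in H. rewrite zero_case, Nat.eqb_eq, negb_zero. lia.
  - pose proof (HG1 (SOr A B) c) as H. cbn [good ssat] in H.
    pose proof (good_sat _ _ _ _ (HG1 A c)) as HA. pose proof (good_sat _ _ _ _ (HG1 B c)) as HB.
    repeat split; auto; intros [-> ->];
      rewrite zero_case, implies_spec, !negb_zero, ?negb_one, ?Nat.eqb_eq;
      destruct (G (npair (scode (SOr A B)) c)) as [|[|]]; try rewrite <- HA, <- HB in H;
      rewrite <- ?HA, <- ?HB in H; lia.
  - split; [exact IH|]. intros [-> [Ha Hc]]. rewrite <- (npair_of k), Ha.
    rewrite <- (npair_of (snd_of k)), Hc. generalize (fst_of (snd_of k)). intros m.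
    rewrite !snd_of_npair, fst_of_npair.
    pose proof (HG1 (SEx A) c) as H. cbn [good ssat] in H.
    pose proof (good_sat _ _ _ _ (HG1 A (npair m c))) as Hm. rewrite get_npair in Hm.
    rewrite zero_case, implies_spec, !negb_zero, !Nat.eqb_eq.
    destruct (G (npair (scode (SEx A)) c)) as [|m'].
    + split; [intros _|lia]. apply Nat.le_0_r, Nat.nlt_ge. intros Hl. apply H. exists m. tauto.
    + split; [lia|]. cbn [pred]. intros _ ->. tauto.
Qed.

(** A node is a finite piece of a satisfaction sequence that violates no constraint and, once it
    reaches the position of the matrix at [n], is positive there. A path is then a full satisfaction
    sequence, whose positions [npair (npair 0 i) t] give the sets. *)
Lemma Sigma11_tree (P : nat -> Prop) :
  Sigma11 P ->
  exists T : nat -> nat -> bool, prb2 T /\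
    (forall n d d', fst_of d <= fst_of d' ->
       (forall j, j < fst_of d -> get (snd_of d) j = get (snd_of d') j) ->
       T n d' = true -> T n d = true) /\
    (forall n, P n <-> exists G, forall d,
       (forall j, j < fst_of d -> get (snd_of d) j = G j) -> T n d = true).
Proof.
  intros [A0 HA]. set (A := simplify A0).
  exists (fun n d => ball (fst_of d) (fun j =>
    implies (j =? npair (scode A) (npair n 0)) (negb (get (snd_of d) j =? 0)) &&
    ball (fst_of d) (fun k => constr A j (get (snd_of d) j) k (get (snd_of d) k)))).
  split; [|split].
  - intros B. pr.
  - intros n d d' Hle He. rewrite !ball_spec. intros H j Hj.
    specialize (H j ltac:(lia)). rewrite Bool.andb_true_iff, ball_spec in *.
    rewrite (He j Hj). split; [apply H|]. intros k Hk. rewrite (He k Hk). apply H. lia.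
  - intros n. rewrite HA. setoid_rewrite <- (ssat_simplify _ A0). fold A.
    replace (scons n (fun _ => 0)) with (get (npair n 0)) by now rewrite get_npair, get_0.
    setoid_rewrite ball_spec. setoid_rewrite Bool.andb_true_iff. setoid_rewrite ball_spec.
    setoid_rewrite implies_spec. setoid_rewrite negb_zero. setoid_rewrite Nat.eqb_eq.
    split.
    + intros [X HX]. destruct (constr_complete X) as [G [HG H]]. exists G.
      intros d Hd j Hj. rewrite (Hd j Hj). split.
      * intros ->. apply (constr_sound G A (H A)).
        replace (fun i t => 0 < G (npair (npair 0 i) t)) with X; [exact HX|].
        extensionality i. extensionality t. symmetry. now apply propositional_extensionality.
      * intros k Hk. rewrite (Hd k Hk). apply H.
    + intros [G HG].
      assert (H : forall j, (j = npair (scode A) (npair n 0) -> 0 < G j) /\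
        forall k, constr A j (G j) k (G k) = true).
      (* A single requirement is already visible on an initial segment long enough to contain its
         one or two positions. *)
      { intros j. split; [intros Ej|intros k].
        - destruct (get_surj G (S j)) as [c Hc].
          specialize (HG (npair (S j) c)). rewrite fst_of_npair, snd_of_npair in HG.
          destruct (HG Hc j) as [H _]; [lia|]. rewrite (Hc j) in H by lia. auto.
        - destruct (get_surj G (S (j + k))) as [c Hc].
          specialize (HG (npair (S (j + k)) c)). rewrite fst_of_npair, snd_of_npair in HG.
          destruct (HG Hc j) as [_ H]; [lia|]. specialize (H k ltac:(lia)).
          now rewrite (Hc j), (Hc k) in H by lia. }
      exists (fun i t => 0 < G (npair (npair 0 i) t)).
      apply (constr_sound G A); [intros j; apply H|]. now apply H.
Qed.

(** * Continuous maps coded by sets *)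

(** Rounded-down halves of [i] and [i + 1] add up to [i], which gives the recursion. *)
Definition half (n : nat) : nat := nat_rect (fun _ => nat) 0 (fun i u => i - u) n.

Lemma half_double n : half (2 * n) = n /\ half (S (2 * n)) = n.
Proof.
  induction n as [|n [IH1 IH2]]; [easy|].
  replace (2 * S n) with (S (S (2 * n))) by lia.
  assert (E : half (S (S (2 * n))) = S n).
  { change (half (S (S (2 * n)))) with (S (2 * n) - half (S (2 * n))). rewrite IH2. lia. }
  split; [exact E|].
  change (half (S (S (S (2 * n))))) with (S (S (2 * n)) - half (S (S (2 * n)))). rewrite E. lia.
Qed.

Lemma pr_half : pr1 half.
Proof. intros B. unfold half. pr. Qed.
#[local] Hint Resolve pr_half : pr.

(** [string_code] is base 2 with digits 1 and 2, the head being least significant: [half (pred c)]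
    removes the head, and the head is [true] when the code is positive and even. *)
Definition str_drop (c i : nat) : nat := Nat.iter i (fun c => half (pred c)) c.
Definition str_bit (c i : nat) : bool :=
  negb (str_drop c i =? 0) && (str_drop c i =? 2 * half (str_drop c i)).
Definition str_len (c : nat) : nat :=
  nat_rect (fun _ => nat) 0 (fun i u => if str_drop c i =? 0 then u else S i) c.

Lemma pr_str_drop : pr2 str_drop.
Proof.
  intros B. unfold str_drop. apply pr_nat_iter with (f := fun _ c => half (pred c)); pr.
Qed.
#[local] Hint Resolve pr_str_drop : pr.

Lemma pr_str_bit : prb2 str_bit.
Proof. intros B. unfold str_bit. pr. Qed.

Lemma pr_str_len : pr1 str_len.
Proof. intros B. unfold str_len. pr. Qed.
#[local] Hint Resolve pr_str_bit pr_str_len : pr.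

Lemma str_drop_code s i : str_drop (string_code s) i = string_code (skipn i s).
Proof.
  revert s. induction i as [|i IH]; intros s; [easy|].
  unfold str_drop in *. rewrite Nat.iter_succ_r. destruct s as [|b s].
  - cbn [string_code]. change (half (pred 0)) with (string_code []). rewrite IH.
    now rewrite skipn_nil.
  - cbn [skipn]. rewrite <- IH. f_equal. destruct b; cbn [string_code].
    + replace (pred (2 * string_code s + 2)) with (S (2 * string_code s)) by lia. apply half_double.
    + replace (pred (2 * string_code s + 1)) with (2 * string_code s) by lia. apply half_double.
Qed.

Lemma string_code_0 s : string_code s = 0 -> s = [].
Proof. destruct s as [|[] s]; cbn [string_code]; [easy|lia|lia]. Qed.

Lemma str_bit_code s i : str_bit (string_code s) i = nth i s false.
Proof.
  unfold str_bit. rewrite str_drop_code.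
  replace (nth i s false) with (nth 0 (skipn i s) false) by now rewrite nth_skipn, Nat.add_0_r.
  destruct (skipn i s) as [|[] t]; [easy| |];
    cbn [string_code nth].
  - replace (2 * string_code t + 2) with (2 * S (string_code t)) by lia.
    rewrite (proj1 (half_double _)), Nat.eqb_refl. destruct (Nat.eqb_spec (2 * S (string_code t)) 0); [lia|easy].
  - rewrite Nat.add_1_r, (proj2 (half_double _)).
    apply Bool.andb_false_iff. right. apply Nat.eqb_neq. lia.
Qed.

Lemma length_string_code s : length s <= string_code s.
Proof. induction s as [|[] s IH]; cbn [length string_code]; lia. Qed.

Lemma str_len_code s : str_len (string_code s) = length s.
Proof.
  unfold str_len.
  (* The recursion runs up to the code itself, which bounds the length, and its value freezes once
     the string is exhausted. *)
  enough (E : forall m, nat_rect (fun _ => nat) 0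
    (fun i u => if str_drop (string_code s) i =? 0 then u else S i) m = min m (length s)).
  { rewrite E. pose proof (length_string_code s). lia. }
  induction m as [|m IH]; [easy|]. cbn [nat_rect]. rewrite IH, str_drop_code.
  destruct (Nat.eqb_spec (string_code (skipn m s)) 0) as [H|H].
  - apply string_code_0, (f_equal (@length bool)) in H. rewrite length_skipn in H. cbn in H. lia.
  - destruct (Nat.le_gt_cases (length s) m) as [L|L]; [|lia].
    apply skipn_all2 in L. now rewrite L in H.
Qed.

Definition prefix (x : nat -> bool) (l : nat) : list bool := map x (seq 0 l).

Definition prefix_code (x : nat -> bool) (l : nat) : nat :=
  nat_rect (fun _ => nat) 0 (fun i u => u + 2 ^ i * S (Nat.b2n (x i))) l.

Lemma string_code_snoc s b : string_code (s ++ [b]) = string_code s + 2 ^ length s * S (Nat.b2n b).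
Proof.
  induction s as [|[] s IH]; [now destruct b| |]; cbn [List.app length string_code];
    rewrite IH, Nat.pow_succ_r'; lia.
Qed.

Lemma prefix_S x l : prefix x (S l) = prefix x l ++ [x l].
Proof. unfold prefix. now rewrite seq_S, map_app. Qed.

Lemma length_prefix x l : length (prefix x l) = l.
Proof. unfold prefix. now rewrite length_map, length_seq. Qed.

Lemma string_code_prefix x l : string_code (prefix x l) = prefix_code x l.
Proof.
  induction l as [|l IH]; [easy|]. rewrite prefix_S, string_code_snoc, IH, length_prefix. reflexivity.
Qed.

Lemma str_len_prefix x l : str_len (prefix_code x l) = l.
Proof. now rewrite <- string_code_prefix, str_len_code, length_prefix. Qed.

Lemma nth_prefix x l i : i < l -> nth i (prefix x l) false = x i.
Proof.
  intros H. unfold prefix. rewrite (nth_indep _ false (x 0)) by (now rewrite length_map, length_seq).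
  now rewrite map_nth, seq_nth.
Qed.

Lemma str_bit_prefix x l i : i < l -> str_bit (prefix_code x l) i = x i.
Proof. intros H. rewrite <- string_code_prefix, str_bit_code. now apply nth_prefix. Qed.

Lemma prefix_code_ext x y l : (forall i, i < l -> x i = y i) -> prefix_code x l = prefix_code y l.
Proof.
  induction l as [|l IH]; intros H; [easy|]. unfold prefix_code in *. cbn [nat_rect].
  rewrite IH, H; auto.
Qed.

Definition decides (x : nat -> bool) (X : nat -> Prop) : Prop := forall i, x i = true <-> X i.

Lemma decides_exists X : exists x, decides x X.
Proof.
  destruct (functional_choice (fun i b => b = true <-> X i)) as [x Hx]; [|now exists x].
  intros i. destruct (classic (X i)); [exists true|exists false]; intuition easy.
Qed.

Lemma initial_segment_prefix x X s :
  decides x X -> initial_segment s X <-> s = prefix x (length s).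
Proof.
  intros Hx. unfold initial_segment. split.
  - intros H. apply (nth_ext _ _ false false); [now rewrite length_prefix|].
    intros i Hi. rewrite nth_prefix by exact Hi.
    specialize (H i Hi). specialize (Hx i). destruct (nth i s false), (x i); intuition congruence.
  - intros E i Hi. rewrite E, nth_prefix by exact Hi. apply Hx.
Qed.

Definition answer (W : nat -> Prop) (n c b : nat) : Prop := W (npair n (npair c b)).

Definition least (P : nat -> Prop) (l : nat) : Prop := P l /\ forall i, i < l -> ~ P i.

Lemma least_exists (P : nat -> Prop) n : P n -> exists l, least P l.
Proof.
  induction n as [n IH] using lt_wf_ind. intros Hn.
  destruct (classic (exists i, i < n /\ P i)) as [[i [Hi HP]]|H]; [eauto|].
  exists n. split; eauto.
Qed.

Lemma least_unique P l l' : least P l -> least P l' -> l = l'.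
Proof.
  intros [H1 H2] [H3 H4]. destruct (Nat.lt_trichotomy l l') as [L|[L|L]]; [|exact L|].
  - now destruct (H4 l L).
  - now destruct (H2 l' L).
Qed.

(** Initial segments of a fixed set are determined by their lengths, so the shortest sufficient
    segment becomes a least number. *)
Lemma first_halt_prefix W X n x s :
  decides x X ->
  first_halt W X n s <-> exists l, s = prefix x l /\ least (fun i => answer W n (prefix_code x i) 0) l.
Proof.
  intros Hx. unfold first_halt. rewrite (initial_segment_prefix x X s Hx). split.
  - intros [Hs [H H']]. exists (length s). split; [exact Hs|]. split.
    + unfold halts in H. now rewrite Hs, string_code_prefix in H.
    + intros i Hi Ha. apply (H' (prefix x i)).
      * apply (initial_segment_prefix x X); auto. now rewrite length_prefix.
      * now rewrite length_prefix.
      * unfold halts. now rewrite string_code_prefix.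
  - intros [l [-> [H H']]]. rewrite length_prefix. split; [easy|]. split.
    + unfold halts. now rewrite string_code_prefix.
    + intros t Ht Hl Ha. apply (initial_segment_prefix x X t Hx) in Ht.
      apply (H' _ Hl). unfold halts in Ha. now rewrite Ht, string_code_prefix in Ha.
Qed.

Lemma defined_prefix W X x :
  decides x X -> defined W X <-> forall n, exists l, answer W n (prefix_code x l) 0.
Proof.
  intros Hx. unfold defined. split; intros H n; destruct (H n) as [l Hl].
  - apply (first_halt_prefix _ _ _ _ _ Hx) in Hl. destruct Hl as [l' [_ [Hl _]]]. eauto.
  - destruct (least_exists (fun l => answer W n (prefix_code x l) 0) l Hl) as [l' Hl'].
    exists (prefix x l'). apply (first_halt_prefix _ _ _ _ _ Hx). eauto.
Qed.

Lemma app_prefix W X x n l :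
  decides x X -> least (fun i => answer W n (prefix_code x i) 0) l ->
  app W X n <-> answer W n (prefix_code x l) 1.
Proof.
  intros Hx Hl. unfold app. split.
  - intros [s [Hs Ha]]. apply (first_halt_prefix _ _ _ _ _ Hx) in Hs. destruct Hs as [l' [-> Hl']].
    rewrite (least_unique _ _ _ Hl Hl'). unfold accepts in Ha. now rewrite string_code_prefix in Ha.
  - intros Ha. exists (prefix x l). split.
    + apply (first_halt_prefix _ _ _ _ _ Hx). eauto.
    + unfold accepts. now rewrite string_code_prefix.
Qed.

Definition map_code (h a : nat -> nat -> bool) (x : nat) : bool :=
  if snd_of (snd_of x) =? 0 then h (fst_of x) (fst_of (snd_of x)) else a (fst_of x) (fst_of (snd_of x)).

Lemma answer_map_code h a n c b :
  answer (fun i => map_code h a i = true) n c b <-> (if b =? 0 then h n c else a n c) = true.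
Proof. unfold answer, map_code. now rewrite !snd_of_npair, !fst_of_npair. Qed.

Lemma pr_map_code h a : prb2 h -> prb2 a -> prb1 (map_code h a).
Proof. intros Hh Ha B. unfold map_code. pr. Qed.

Lemma recursive_set_bool f : prb1 f -> recursive_set (fun x => f x = true).
Proof.
  intros Hf. destruct (PR_recursive (fun x => Nat.b2n (f x)) (Hf _)) as [p Hp].
  exists p. intros n. specialize (Hp n). destruct (f n); split; easy.
Qed.

Lemma recursive_set_decides X :
  recursive_set X -> exists x, decides x X /\ recursive_function (fun i => Nat.b2n (x i)).
Proof.
  intros [p Hp]. destruct (decides_exists X) as [x Hx]. exists x. split; [exact Hx|].
  exists p. intros n. destruct (Hp n) as [H1 H0]. destruct (x n) eqn:E.
  - now apply H1, Hx.
  - apply H0. intros HX. apply Hx in HX. congruence.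
Qed.

Lemma recursive_min (t : nat -> nat -> bool) :
  PR recursive_function 2 (fun e => Nat.b2n (t (e 0) (e 1))) ->
  (forall x, exists m, t x m = true) ->
  exists h, recursive_function h /\ forall x, least (fun m => t x m = true) (h x).
Proof.
  intros Ht Hex.
  (* [PMu] searches on the first coordinate for the value 0; hence the swapped arguments and the
     negation. *)
  assert (H : PR recursive_function 2 (fun e => Nat.b2n (negb (t (e 1) (e 0))))).
  { apply (pr_negb _ 2 (fun e => t (e 1) (e 0))).
    refine (pr_ren _ 2 2 (fun i => 1 - i) (fun e => Nat.b2n (t (e 0) (e 1))) Ht _). lia. }
  apply PR_computable in H. destruct H as [p Hp].
  destruct (functional_choice (fun x l => least (fun m => t x m = true) l)) as [h Hh].
  { intros x. destruct (Hex x) as [m Hm]. apply (least_exists _ m Hm). }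
  exists h. split; [|exact Hh]. exists (PMu p). intros x. destruct (Hh x) as [H0 H1].
  assert (He : forall m, eval p [m; x] (Nat.b2n (negb (t x m))))
    by (intros m; exact (Hp (scons m (fun _ => x)))).
  (* Before the least solution the negated test has value 1, that is [S 0]. *)
  apply ev_mu with (w := fun _ => 0).
  - intros m Hm. specialize (He m). apply H1, Bool.not_true_is_false in Hm. now rewrite Hm in He.
  - specialize (He (h x)). now rewrite H0 in He.
Qed.

Lemma pr_prefix_code B k x l :
  PR B (S k) (fun e => Nat.b2n (x (fun i => e (S i)) (e 0))) -> PR B k l ->
  PR B k (fun e => prefix_code (x e) (l e)).
Proof.
  intros Hx Hl. unfold prefix_code.
  assert (H : PR B (S (S k)) (fun e => Nat.b2n (x (fun i => e (S (S i))) (e 0)))).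
  { refine (pr_ren B (S k) (S (S k)) (fun i => match i with 0 => 0 | S i => S (S i) end) _ Hx _).
    intros [|i]; lia. }
  pr; assumption.
Qed.

(** This is [phi_e(e) = z]: [stage] runs [e] on itself. *)
Definition returns (e z : nat) : Prop := exists k, stage e k = S z.

Lemma returns_fun e z z' : returns e z -> returns e z' -> z = z'.
Proof. intros [k Hk] [k' Hk']. eapply stage_fun; eauto. Qed.

(** From recursive [W] and [X], the numbers avoiding [phi_e(e)] could be computed by a recursive
    [g]; at an index of [g] itself this is contradictory. *)
Lemma no_recursive_dnr W X :
  recursive_set W -> recursive_set X -> defined W X ->
  (forall e, exists z, least (fun z => app W X (npair e z)) z /\ ~ returns e z) -> False.
Proof.
  intros HW HX Hdef H.
  apply recursive_set_decides in HW as [w [Hw Rw]]. apply recursive_set_decides in HX as [x [Hx Rx]].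
  rewrite (defined_prefix W X x Hx) in Hdef.
  assert (Px : forall k l, PR recursive_function k l ->
    PR recursive_function k (fun e => prefix_code x (l e))).
  { intros k l Hl. apply (pr_prefix_code _ k (fun _ => x)); [|exact Hl].
    apply (pr_base _ _ _ _ Rx). pr. }
  (* [h n] is the number of bits of [X] that [W] reads before answering question [n]. *)
  destruct (recursive_min (fun n l => w (npair n (npair (prefix_code x l) 0)))) as [h [Rh Hh]].
  { apply (pr_base _ 2 _ (fun e => npair (e 0) (npair (prefix_code x (e 1)) 0)) Rw).
    apply (pr_app2 _ 2 npair); [auto with pr|pr|].
    apply (pr_app2 _ 2 npair); [auto with pr| |pr]. apply Px. pr. }
  { intros n. destruct (Hdef n) as [l Hl]. exists l. now apply Hw. }
  assert (A : forall e z, app W X (npair e z) <->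
    w (npair (npair e z) (npair (prefix_code x (h (npair e z))) 1)) = true).
  { intros e z. rewrite (Hw _). apply app_prefix; [exact Hx|].
    destruct (Hh (npair e z)) as [H1 H2]. split; [now apply Hw|].
    intros i Hi Ha. apply (H2 i Hi). now apply Hw. }
  (* [g e] is the number chosen for [e] by the output of [W] on [X]. *)
  destruct (recursive_min (fun e z =>
    w (npair (npair e z) (npair (prefix_code x (h (npair e z))) 1)))) as [g [Rg Hg]].
  { apply (pr_base _ 2 _ (fun e => npair (npair (e 0) (e 1))
      (npair (prefix_code x (h (npair (e 0) (e 1)))) 1)) Rw).
    apply (pr_app2 _ 2 npair); [auto with pr|pr|].
    apply (pr_app2 _ 2 npair); [auto with pr| |pr]. apply Px. apply (pr_base _ _ _ _ Rh). pr. }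
  { intros e. destruct (H e) as [z [[Hz _] _]]. exists z. now apply A. }
  destruct (stage_universal g Rg) as [e He].
  destruct (H e) as [z [Hz Hr]]. apply Hr. replace z with (g e); [exact He|].
  apply (least_unique _ _ _ (Hg e)). destruct Hz as [Hz1 Hz2].
  split; [now apply A|]. intros i Hi. rewrite <- A. auto.
Qed.

(** * The reduction *)

Lemma form_code_inj A : forall B, form_code A = form_code B -> A = B.
Proof.
  induction A; intros []; cbn [form_code]; intros; npair_inj; f_equal; auto using term_code_inj.
Qed.

Fixpoint num (n : nat) : term := match n with 0 => Zero | S n => Add One (num n) end.

Lemma term_val_num e n : term_val e (num n) = n.
Proof. induction n as [|n IH]; cbn; congruence. Qed.

Lemma bounded_num b n : bounded_term b (num n).
Proof. induction n; cbn; auto. Qed.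

Lemma pr_num : pr1 (fun n => term_code (num n)).
Proof.
  intros B. apply (pr_ext B 1 (fun e => nat_rect (fun _ => nat) (npair 1 0)
    (fun _ u => npair 3 (npair (npair 2 0) u)) (e 0))); [pr|].
  intros e. induction (e 0) as [|n IH]; [easy|]. cbn [nat_rect num term_code]. now rewrite <- IH.
Qed.
#[local] Hint Extern 0 (PR _ _ (fun e => term_code (num (@?a e)))) =>
  apply (pr_app1 _ _ (fun n => term_code (num n)) a); [apply pr_num|pr] : pr_goal.

(* [D] with its variable 0 replaced by the numeral of [n]. *)
Definition inst (n : nat) (D : form) : form := Ex (And (Eq (Var 0) (num n)) D).

Lemma has_witness_inst n D e :
  (exists Y, witness (inst n D) e Y) <-> exists Y, witness D (scons n e) Y.
Proof.
  unfold inst. rewrite has_witness_ex. setoid_rewrite has_witness_and.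
  cbn [witness]. setoid_rewrite term_val_num. cbn [term_val scons]. split.
  - intros [m [[_ ->] H]]. exact H.
  - intros H. exists n. split; [now exists (fun _ => True)|exact H].
Qed.

Lemma bounded_inst b n D : bounded (S b) D -> bounded b (inst n D).
Proof. intros H. cbn. repeat split; auto using bounded_num. lia. Qed.

Section Tree.

(* [T n d]: the sequence of length [fst_of d] coded by [snd_of d] is in the tree of [n]. *)
Variable T : nat -> nat -> bool.
Hypothesis pr_T : prb2 T.
Hypothesis T_closed : forall n d d', fst_of d <= fst_of d' ->
  (forall j, j < fst_of d -> get (snd_of d) j = get (snd_of d') j) ->
  T n d' = true -> T n d = true.

Definition diag_in (n e b : nat) : Prop := exists d, returns e (npair d b) /\ T n d = true.

(** Its negation is the first alternative in [A(e)]. When [e] returns a node too short to have a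
    [j]-th entry, every [y] is off, so that only [I(e)] can serve at [j]. *)
Definition diag_off (n y j e : nat) : Prop :=
  exists d b, returns e (npair d b) /\ T n d = true /\ ~ (j < fst_of d /\ y = get (snd_of d) j).

Definition diag_in_at (n b w : nat) : bool :=
  negb (w =? 0) && ((snd_of (pred w) =? b) && T n (fst_of (pred w))).

Definition diag_off_at (n y j w : nat) : bool :=
  negb (w =? 0) && (T n (fst_of (pred w)) &&
    negb ((j <? fst_of (fst_of (pred w))) && (y =? get (snd_of (fst_of (pred w))) j))).

Lemma diag_in_iff n e b : diag_in n e b <-> exists k, diag_in_at n b (stage e k) = true.
Proof.
  unfold diag_in, diag_in_at, returns. split.
  - intros [d [[k Hk] HT]]. exists k. rewrite Hk. cbn [Nat.eqb negb pred].
    now rewrite snd_of_npair, fst_of_npair, HT, Nat.eqb_refl.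
  - intros [k Hk]. destruct (stage e k) as [|w] eqn:E; [easy|]. cbn [Nat.eqb negb pred] in Hk.
    apply Bool.andb_true_iff in Hk as [_ Hk]. apply Bool.andb_true_iff in Hk as [Hb HT].
    apply Nat.eqb_eq in Hb. subst b. exists (fst_of w). rewrite npair_of. eauto.
Qed.

Lemma diag_off_iff n y j e : diag_off n y j e <-> exists k, diag_off_at n y j (stage e k) = true.
Proof.
  unfold diag_off, diag_off_at, returns. split.
  - intros [d [b [[k Hk] [HT H]]]]. exists k. rewrite Hk. cbn [Nat.eqb negb pred andb].
    rewrite fst_of_npair, HT. cbn [andb]. apply Bool.negb_true_iff, Bool.not_true_is_false.
    now rewrite Bool.andb_true_iff, Nat.ltb_lt, Nat.eqb_eq.
  - intros [k Hk]. destruct (stage e k) as [|w] eqn:E; [easy|]. cbn [Nat.eqb negb pred andb] in Hk.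
    apply Bool.andb_true_iff in Hk as [HT H].
    apply Bool.negb_true_iff, Bool.not_true_iff_false in H.
    rewrite Bool.andb_true_iff, Nat.ltb_lt, Nat.eqb_eq in H.
    exists (fst_of w), (snd_of w). rewrite npair_of. eauto.
Qed.

#[local] Hint Resolve pr_T : pr.

Lemma def_diag_in k i b : 0 < k -> i < k -> definable k (fun e => diag_in (e 0) (e i) b).
Proof.
  intros Hk Hi. eapply def_iff;
    [apply (def_PR_ex k (fun e => diag_in_at (e 1) b (stage (e (S i)) (e 0))))|].
  - unfold diag_in_at. pr.
  - intros e. cbn [scons]. symmetry. apply diag_in_iff.
Qed.

Lemma def_diag_off : definable 4 (fun e => diag_off (e 0) (e 1) (e 2) (e 3)).
Proof.
  eapply def_iff;
    [apply (def_PR_ex 4 (fun e => diag_off_at (e 1) (e 2) (e 3) (stage (e 4) (e 0))))|].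
  - unfold diag_off_at. pr.
  - intros e. cbn [scons]. symmetry. apply diag_off_iff.
Qed.

Lemma def_returns : definable 2 (fun e => returns (e 1) (e 0)).
Proof.
  eapply def_iff; [apply (def_PR_ex 2 (fun e => stage (e 2) (e 0) =? S (e 1)))|].
  - pr.
  - intros e. cbn [scons]. unfold returns. now setoid_rewrite Nat.eqb_eq.
Qed.

Definition info (D0 D1 : form) (n : nat) : form := Or (Neg (inst n D0)) (Neg (inst n D1)).

Definition sentence_of (D0 D1 E0 E1 Q R : form) (n : nat) : form :=
  Imp (All (Imp (All (Or (Ex (Neg (inst n Q))) (info E0 E1 n))) (info D0 D1 n)))
      (All (Ex (Neg R))).

(** Only the numeral inside [inst] varies with [n]; the codes of the six given formulas are
    constants. *)
Lemma pr_sentence_of D0 D1 E0 E1 Q R : pr1 (fun n => form_code (sentence_of D0 D1 E0 E1 Q R n)).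
Proof.
  intros B. unfold sentence_of, info, inst. cbn [form_code]. pr.
Qed.

(* [diag_in n e b] is [P_b(e)], and the witnesses of [I(e)] that contain 0 claim [~P_0(e)]. *)
Definition informed (n e : nat) (p : Prop) : Prop :=
  (p /\ ~ diag_in n e 0) \/ (~ p /\ ~ diag_in n e 1).

(* Being a witness of [A(e)], of the premise and of the conclusion of the sentence amounts to
   [guide], [follows] and [avoids]. *)
Definition guide (n e : nat) (Y : nat -> Prop) : Prop := forall j,
  (Y (npair j 0) /\ exists y, least (fun y => Y (npair j (S y))) y /\ ~ diag_off n y j e) \/
  (~ Y (npair j 0) /\ informed n e (Y (npair j 1))).

Definition follows (n : nat) (X : nat -> Prop) : Prop := forall e Y, guide n e Y ->
  defined (fun k => X (npair e k)) Y /\ informed n e (app (fun k => X (npair e k)) Y 0).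

Definition avoids (V : nat -> Prop) : Prop := forall e,
  exists z, least (fun z => V (npair e z)) z /\ ~ returns e z.

(** Negations carry no information, so their clauses collapse to truth; what remains of a witness
    are the choices of disjuncts, the chosen numbers and the continuous maps. *)
Lemma sentence_exists : exists F : nat -> form,
  (forall n, sentence (F n)) /\ recursive_function (fun n => form_code (F n)) /\
  forall n e W, witness (F n) e W <->
    forall X, follows n X -> defined W X /\ avoids (app W X).
Proof.
  (* [D0], [D1] stand directly below the quantifier over [e]; [E0], [E1] say the same below the
     further quantifier over [j]. *)
  destruct (def_diag_in 2 1 0) as [D0 [BD0 HD0]]; [lia..|].
  destruct (def_diag_in 2 1 1) as [D1 [BD1 HD1]]; [lia..|].
  destruct (def_diag_in 3 2 0) as [E0 [BE0 HE0]]; [lia..|].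
  destruct (def_diag_in 3 2 1) as [E1 [BE1 HE1]]; [lia..|].
  destruct def_diag_off as [Q [BQ HQ]]. destruct def_returns as [R [BR HR]].
  exists (sentence_of D0 D1 E0 E1 Q R). split; [|split].
  - intros n. unfold sentence, sentence_of, info. cbn [bounded].
    pose proof bounded_inst. intuition auto.
  - apply PR_recursive, pr_sentence_of.
  - intros n e W. unfold sentence_of, info.
    cbn [witness]. setoid_rewrite has_witness_inst.
    setoid_rewrite HD0. setoid_rewrite HD1. setoid_rewrite HE0. setoid_rewrite HE1.
    setoid_rewrite HQ. setoid_rewrite HR. cbn [scons].
    assert (L : forall (V : nat -> Prop) (P : nat -> Prop),
      (exists y, V y /\ (forall m, m < y -> ~ V m) /\ P y) <-> (exists y, least V y /\ P y)).
    { intros V P. unfold least. split; intros [y H]; exists y; tauto. }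
    setoid_rewrite L. reflexivity.
Qed.

Lemma informed_iff n e p q : (p <-> q) -> informed n e p -> informed n e q.
Proof. unfold informed. tauto. Qed.

Lemma diag_in_fun n e b b' : diag_in n e b -> diag_in n e b' -> b = b'.
Proof.
  intros [d [H _]] [d' [H' _]]. pose proof (returns_fun _ _ _ H H') as E.
  now apply npair_inj in E.
Qed.

Lemma bound_exists (f : nat -> nat) N : exists M, forall i, i < N -> f i < M.
Proof.
  induction N as [|N [M HM]]; [exists 0; lia|].
  exists (S (M + f N)). intros i Hi. destruct (Nat.eq_dec i N) as [->|]; [lia|].
  specialize (HM i). lia.
Qed.

(** * The recursive witness of the premise for a tree without a path *)

Definition info_at (s d : nat) : bool :=
  (npair d 0 <? str_len s) && ((npair d 1 <? str_len s) && negb (str_bit s (npair d 0))).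

Definition value_at (s j y : nat) : bool :=
  (npair j 0 <? str_len s) && (str_bit s (npair j 0) &&
  ((npair j (S y) <? str_len s) && (str_bit s (npair j (S y)) &&
  ball y (fun k => negb (str_bit s (npair j (S k))))))).

Definition left_at (n s d : nat) : bool :=
  negb (T n d) && ball (fst_of d) (fun j => value_at s j (get (snd_of d) j)).

(** The length of the segment dictates the candidate to be tested, a position or a node. Each
    candidate recurs at arbitrarily large lengths, so this dovetails the whole search while each
    test stays primitive recursive. *)
Definition follow_halts (n s : nat) : bool :=
  info_at s (fst_of (str_len s)) || left_at n s (fst_of (str_len s)).

Definition follow_accepts (s : nat) : bool :=
  if info_at s (fst_of (str_len s)) then str_bit s (npair (fst_of (str_len s)) 1) else true.

(** [e] is dropped by [snd_of] and the question is ignored: the output should witness a disjunction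
    of negations, where only membership of 0 matters. *)
Definition follower (n x : nat) : bool :=
  map_code (fun _ => follow_halts n) (fun _ => follow_accepts) (snd_of x).

Lemma pr_info_at : prb2 info_at.
Proof. intros B. unfold info_at. pr. Qed.

Lemma pr_value_at : prb3 value_at.
Proof. intros B. unfold value_at. pr. Qed.
#[local] Hint Resolve pr_info_at pr_value_at : pr.

Lemma pr_follower n : prb1 (follower n).
Proof.
  intros B. unfold follower.
  assert (H1 : prb2 (fun _ : nat => follow_halts n)) by (intros B'; unfold follow_halts, left_at; pr).
  assert (H2 : prb2 (fun _ : nat => follow_accepts)) by (intros B'; unfold follow_accepts; pr).
  apply (pr_app1 B 1 (fun x => Nat.b2n (map_code _ _ x)) (fun e => snd_of (e 0))); [|pr].
  now apply pr_map_code.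
Qed.

Lemma info_at_spec y l d :
  info_at (prefix_code y l) d = true <->
  npair d 0 < l /\ npair d 1 < l /\ y (npair d 0) = false.
Proof.
  unfold info_at. rewrite str_len_prefix, !Bool.andb_true_iff, !Nat.ltb_lt, Bool.negb_true_iff.
  split; intros [H1 [H2 H3]]; rewrite str_bit_prefix in *; auto.
Qed.

Lemma value_at_spec y l j v :
  value_at (prefix_code y l) j v = true <->
  npair j 0 < l /\ npair j (S v) < l /\ y (npair j 0) = true /\
  least (fun v => y (npair j (S v)) = true) v.
Proof.
  unfold value_at, least. rewrite str_len_prefix, !Bool.andb_true_iff, !Nat.ltb_lt, ball_spec.
  split.
  - intros [H1 [H2 [H3 [H4 H5]]]]. rewrite str_bit_prefix in H2, H4 by assumption.
    repeat split; auto. intros i Hi. specialize (H5 i Hi).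
    (* Smaller values have smaller positions, so they lie within the segment as well. *)
    pose proof (npair_mono j (S i) (S v)).
    rewrite str_bit_prefix, Bool.negb_true_iff in H5 by lia. congruence.
  - intros [H1 [H2 [H3 [H4 H5]]]]. rewrite !str_bit_prefix by assumption. repeat split; auto.
    intros i Hi. pose proof (npair_mono j (S i) (S v)). rewrite str_bit_prefix by lia.
    apply Bool.negb_true_iff, Bool.not_true_is_false. auto.
Qed.

(** Information found in [Y] is passed on. If instead [Y] lists a node [d] outside the tree, then
    any tree node returned by [e] would extend [d], contradicting [T_closed]; so either claim is
    true, and the first is made. *)
Lemma follower_sound n e Y y l :
  guide n e Y -> decides y Y -> follow_halts n (prefix_code y l) = true ->
  informed n e (follow_accepts (prefix_code y l) = true).
Proof.
  intros HY Hy. unfold follow_halts, follow_accepts. rewrite str_len_prefix.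
  set (d := fst_of l). destruct (info_at (prefix_code y l) d) eqn:E.
  - intros _. apply info_at_spec in E as [H0 [H1 E]].
    rewrite str_bit_prefix by exact H1. destruct (HY d) as [[H _]|[_ H]].
    + apply Hy in H. congruence.
    + revert H. apply informed_iff. symmetry. apply Hy.
  - cbn [orb]. unfold left_at. rewrite Bool.andb_true_iff, ball_spec. intros [HT Hv].
    left. split; [easy|]. intros [d' [Hd' HT']].
    assert (H : forall j, j < fst_of d -> j < fst_of d' /\ get (snd_of d) j = get (snd_of d') j).
    { intros j Hj. apply NNPP. intros Hn.
      specialize (Hv j Hj). apply value_at_spec in Hv as [_ [_ [H0 Hl]]].
      destruct (HY j) as [[_ [v [Hl' Hoff]]]|[Hj0 _]]; [|now apply Hj0, Hy].
      apply Hoff. exists d', 0. repeat split; auto. intros [H1 H2]. apply Hn. split; [exact H1|].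
      rewrite <- H2. apply (least_unique _ _ _ Hl).
      destruct Hl' as [Hl1 Hl2]. split; [now apply Hy|]. intros i Hi Hyi. apply (Hl2 i Hi). now apply Hy. }
    rewrite (T_closed n d d') in HT; [easy| |apply H|exact HT'].
    destruct (fst_of d) as [|m]; [lia|]. destruct (H m); lia.
Qed.

(** Either [Y] somewhere offers a witness of [I(e)], or its values form an infinite sequence, which
    must leave the tree. *)
Lemma follower_total n e Y y :
  guide n e Y -> decides y Y ->
  (forall G, exists d, (forall j, j < fst_of d -> get (snd_of d) j = G j) /\ T n d = false) ->
  exists l, follow_halts n (prefix_code y l) = true.
Proof.
  intros HY Hy HT.
  destruct (classic (exists j, y (npair j 0) = false)) as [[j Hj]|Hn].
  (* The first component selects the candidate [j]; the second makes the length exceed both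
     positions to be read. *)
  - exists (npair j (S (npair j 0 + npair j 1))). unfold follow_halts.
    rewrite str_len_prefix, fst_of_npair.
    replace (info_at _ j) with true; [easy|]. symmetry. apply info_at_spec.
    pose proof (npair_ge j (S (npair j 0 + npair j 1))). repeat split; auto; lia.
  - destruct (functional_choice (fun j v => least (fun v => y (npair j (S v)) = true) v)) as [G HG].
    { intros j. destruct (HY j) as [[_ [v [[Hv _] _]]]|[H _]].
      - apply (least_exists _ v). now apply Hy.
      - destruct Hn. exists j. apply Bool.not_true_is_false. now rewrite (Hy _). }
    destruct (HT G) as [d [Hd HTd]].
    destruct (bound_exists (fun j => npair j 0 + npair j (S (G j))) (fst_of d)) as [M HM].
    exists (npair d M). unfold follow_halts. rewrite str_len_prefix, fst_of_npair.
    replace (left_at n _ d) with true; [apply Bool.orb_true_r|]. symmetry.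
    unfold left_at. rewrite HTd. cbn [negb andb]. apply ball_spec. intros j Hj.
    specialize (HM j Hj). pose proof (npair_ge d M). apply value_at_spec. rewrite (Hd j Hj).
    repeat split; try lia; [|apply HG|apply HG].
    apply Bool.not_false_is_true. eauto.
Qed.

Lemma follower_follows n :
  (forall G, exists d, (forall j, j < fst_of d -> get (snd_of d) j = G j) /\ T n d = false) ->
  follows n (fun x => follower n x = true).
Proof.
  intros HT e Y HY. destruct (decides_exists Y) as [y Hy].
  assert (E : (fun k => follower n (npair e k) = true) =
    (fun k => map_code (fun _ => follow_halts n) (fun _ => follow_accepts) k = true)).
  { apply pred_ext. intros k. unfold follower. now rewrite snd_of_npair. }
  rewrite E. destruct (follower_total n e Y y HY Hy HT) as [l Hl]. split.
  - apply (defined_prefix _ _ _ Hy). intros q. exists l. now apply (proj2 (answer_map_code _ _ _ _ _)).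
  - destruct (least_exists (fun l => follow_halts n (prefix_code y l) = true) l Hl) as [m [Hm1 Hm2]].
    apply (informed_iff n e (follow_accepts (prefix_code y m) = true)).
    + symmetry. etransitivity; [apply (app_prefix _ _ _ _ m Hy)|apply answer_map_code].
      split; [now apply (proj2 (answer_map_code _ _ _ _ _))|]. intros i Hi Ha. apply (proj1 (answer_map_code _ _ _ _ _)) in Ha.
      exact (Hm2 i Hi Ha).
    + exact (follower_sound n e Y y m HY Hy Hm1).
Qed.

(* The witness of [A(e)] claiming the value [G j] for every [j]. *)
Definition pure (G : nat -> nat) (i : nat) : bool :=
  (snd_of i =? 0) || (snd_of i =? S (G (fst_of i))).

Lemma pure_spec G j :
  pure G (npair j 0) = true /\ forall v, pure G (npair j (S v)) = true <-> v = G j.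
Proof.
  unfold pure. rewrite fst_of_npair, snd_of_npair. split; [easy|]. intros v.
  rewrite fst_of_npair, snd_of_npair. cbn [Nat.eqb orb]. apply Nat.eqb_eq.
Qed.

Lemma guide_value n e (Y : nat -> Prop) j y :
  Y (npair j 0) -> (forall v, Y (npair j (S v)) <-> v = y) -> ~ diag_off n y j e ->
  Y (npair j 0) /\ exists y, least (fun y => Y (npair j (S y))) y /\ ~ diag_off n y j e.
Proof.
  intros H0 H1 Hy. split; [exact H0|]. exists y. split; [|exact Hy].
  split; [now apply H1|]. intros i Hi E. apply H1 in E. lia.
Qed.

(** * The recursive witness of the sentence for a tree with a path *)

Definition question (e c b : nat) : nat := npair e (npair 0 (npair c b)).

Definition trace (c l : nat) : nat := prefix_code (pure (get c)) l.

(** The segment [s] of [X] shows that the map given by [X] at [e], fed with the values listed in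
    [d], first answers about 0 after exactly [fst_of d] bits. Since [fst_of k <= k], these bits
    involve only entries of [d]. *)
Definition trial_at (e s d : nat) : bool :=
  (question e (trace (snd_of d) (fst_of d)) 0 <? str_len s) &&
  ((question e (trace (snd_of d) (fst_of d)) 1 <? str_len s) &&
  (str_bit s (question e (trace (snd_of d) (fst_of d)) 0) &&
  ball (fst_of d) (fun i => (question e (trace (snd_of d) i) 0 <? str_len s) &&
    negb (str_bit s (question e (trace (snd_of d) i) 0))))).

(** Again the length of the segment selects the candidate, used both as a running time for [e] and
    as a node. *)
Definition avoid_halts (n e s : nat) : bool :=
  negb (stage e (fst_of (str_len s)) =? 0) ||
  (T n (fst_of (str_len s)) && trial_at e s (fst_of (str_len s))).

(** An answer containing 0 claims [~P_0(e)] and leads to [<d,0>]; otherwise the claim is [~P_1(e)]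
    and leads to [<d,1>]. *)
Definition trial_value (e s d : nat) : nat :=
  npair d (Nat.b2n (negb (str_bit s (question e (trace (snd_of d) (fst_of d)) 1)))).

(** If [e] has returned [z], then [stage] yields [S z], already a number different from [z]. *)
Definition avoid_value (e s : nat) : nat :=
  if stage e (fst_of (str_len s)) =? 0 then trial_value e s (fst_of (str_len s))
  else stage e (fst_of (str_len s)).

Definition avoider (n x : nat) : bool :=
  map_code (fun q s => avoid_halts n (fst_of q) s) (fun q s => snd_of q =? avoid_value (fst_of q) s) x.

Lemma pr_trace : pr2 trace.
Proof.
  intros B. unfold trace.
  apply (pr_prefix_code B 2 (fun e => pure (get (e 0))) (fun e => e 1)); [|pr].
  unfold pure. pr.
Qed.

Lemma pr_question : pr3 question.
Proof. intros B. unfold question. pr. Qed.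
#[local] Hint Resolve pr_trace pr_question : pr.

Lemma pr_trial_at : prb3 trial_at.
Proof. intros B. unfold trial_at. pr. Qed.

Lemma pr_trial_value : pr3 trial_value.
Proof. intros B. unfold trial_value. pr. Qed.
#[local] Hint Resolve pr_trial_at pr_trial_value : pr.

Lemma pr_avoider n : prb1 (avoider n).
Proof.
  apply pr_map_code; intros B; unfold avoid_halts, avoid_value; pr.
Qed.

Lemma trial_at_spec e x l d :
  trial_at e (prefix_code x l) d = true <->
  question e (trace (snd_of d) (fst_of d)) 1 < l /\
  (forall i, i <= fst_of d -> question e (trace (snd_of d) i) 0 < l) /\
  least (fun i => x (question e (trace (snd_of d) i) 0) = true) (fst_of d).
Proof.
  unfold trial_at, least.
  rewrite str_len_prefix, !Bool.andb_true_iff, !Nat.ltb_lt, ball_spec.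
  split.
  - intros [H1 [H2 [H3 H4]]]. rewrite str_bit_prefix in H3 by assumption. split; [exact H2|].
    split; [|split; [exact H3|]].
    + intros i Hi. destruct (Nat.eq_dec i (fst_of d)) as [->|]; [exact H1|].
      specialize (H4 i). rewrite Bool.andb_true_iff, Nat.ltb_lt in H4. apply H4. lia.
    + intros i Hi. specialize (H4 i Hi).
      rewrite Bool.andb_true_iff, Nat.ltb_lt, Bool.negb_true_iff in H4. destruct H4 as [H5 H6]. rewrite str_bit_prefix in H6 by exact H5. congruence.
  - intros [H1 [H2 [H3 H4]]]. rewrite str_bit_prefix by auto. repeat split; auto.
    intros i Hi. rewrite Bool.andb_true_iff, Nat.ltb_lt, Bool.negb_true_iff. split.
    + apply H2. lia.
    + rewrite str_bit_prefix by (apply H2; lia). apply Bool.not_true_is_false. auto.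
Qed.

Lemma avoider_sound n X x e l :
  follows n X -> decides x X -> avoid_halts n e (prefix_code x l) = true ->
  ~ returns e (avoid_value e (prefix_code x l)).
Proof.
  intros HX Hx. unfold avoid_halts, avoid_value. rewrite str_len_prefix.
  set (d := fst_of l). destruct (stage e d) as [|z] eqn:Es.
  2:{ intros _ Hr. assert (H : returns e z) by now exists d.
      apply (returns_fun e z) in Hr; [cbn in Hr; lia|exact H]. }
  cbn [Nat.eqb negb orb]. rewrite Bool.andb_true_iff. intros [HT Ht] Hr.
  apply trial_at_spec in Ht as [H1 [_ Hl]].
  unfold trial_value in Hr. rewrite str_bit_prefix in Hr by exact H1.
  set (L := fst_of d) in *. set (a := x (question e (trace (snd_of d) L) 1)) in *.
  (* Supposing [e] returns the trial value, [d] is completed to a witness of [A(e)]: its entries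
     below [L], and from [L] on the claim opposite to that of [X], which is true. *)
  set (Y := fun i => if fst_of i <? L then pure (get (snd_of d)) i
                     else (snd_of i =? 1) && negb a).
  assert (Hin : diag_in n e (Nat.b2n (negb a))) by now exists d.
  assert (Hi : informed n e (negb a = true)).
  { destruct a; cbn in *.
    - right. split; [easy|]. intros H. now pose proof (diag_in_fun _ _ _ _ Hin H).
    - left. split; [easy|]. intros H. now pose proof (diag_in_fun _ _ _ _ Hin H). }
  assert (HY : guide n e (fun i => Y i = true)).
  { intros j.
    assert (E : forall k, Y (npair j k) =
      if j <? L then pure (get (snd_of d)) (npair j k) else (k =? 1) && negb a).
    { intros k. unfold Y. now rewrite fst_of_npair, snd_of_npair. }
    destruct (Nat.ltb_spec j L) as [Hj|Hj].
    - left. apply (guide_value n e (fun i => Y i = true) j (get (snd_of d) j)).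
      + rewrite E. apply pure_spec.
      + intros v. rewrite E. apply pure_spec.
      + intros [d' [b [Hr' [_ Hoff]]]]. apply (returns_fun _ _ _ Hr), npair_inj in Hr' as [<- _].
        now apply Hoff.
    - right. rewrite !E. split; [easy|exact Hi]. }
  destruct (HX e _ HY) as [_ Hinf].
  assert (Hy : decides Y (fun i => Y i = true)) by easy.
  (* The completion changes no bit before position [L], so [X] cannot tell it from the trial. *)
  assert (E : forall i, i <= L -> prefix_code Y i = trace (snd_of d) i).
  { intros i Hi'. apply prefix_code_ext. intros k Hk. unfold Y.
    pose proof (fst_of_le k). destruct (Nat.ltb_spec (fst_of k) L); [easy|lia]. }
  assert (Happ : app (fun k => X (npair e k)) (fun i => Y i = true) 0 <-> a = true).
  { etransitivity; [apply (app_prefix _ _ _ _ L Hy)|].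
    - destruct Hl as [Hl1 Hl2]. split.
      + unfold answer. rewrite E by lia. now apply Hx.
      + intros i Hi' Ha. unfold answer in Ha. rewrite E in Ha by lia. apply (Hl2 i Hi'). now apply Hx.
    - unfold answer. rewrite E by lia. symmetry. apply Hx. }
  (* On [Y] the map repeats the claim [a], which denies exactly the [P_b(e)] that holds. *)
  apply (informed_iff _ _ _ _ Happ) in Hinf.
  destruct Hinf as [[-> H]|[H H']]; [now apply H|].
  apply Bool.not_true_is_false in H. now rewrite H in *.
Qed.

(** If [e] halts, a running time is found. Otherwise nothing is off, so the path [G] gives a witness
    of [A(e)], and the map of [X] answers after reading finitely much of it. *)
Lemma avoider_total n X x e G :
  follows n X -> decides x X ->
  (forall d, (forall j, j < fst_of d -> get (snd_of d) j = G j) -> T n d = true) ->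
  exists l, avoid_halts n e (prefix_code x l) = true.
Proof.
  intros HX Hx HG.
  destruct (classic (exists k, stage e k <> 0)) as [[k Hk]|Hn].
  { exists (npair k 0). unfold avoid_halts. rewrite str_len_prefix, fst_of_npair.
    apply Nat.eqb_neq in Hk. now rewrite Hk. }
  assert (HY : guide n e (fun i => pure G i = true)).
  { intros j. left. apply (guide_value n e (fun i => pure G i = true) j (G j)); [apply pure_spec|intros v; apply pure_spec|].
    intros [d [b [[k Hk] _]]]. apply Hn. exists k. lia. }
  destruct (HX e _ HY) as [Hdef _].
  assert (Hy : decides (pure G) (fun i => pure G i = true)) by easy.
  destruct (proj1 (defined_prefix _ _ _ Hy) Hdef 0) as [l0 Hl0].
  destruct (least_exists (fun l => answer (fun k => X (npair e k)) 0 (prefix_code (pure G) l) 0)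
    l0 Hl0) as [L [HL1 HL2]].
  destruct (get_surj G L) as [c Hc].
  assert (E : forall i, i <= L -> trace c i = prefix_code (pure G) i).
  { intros i Hi. apply prefix_code_ext. intros k Hk. unfold pure.
    pose proof (fst_of_le k). rewrite Hc by lia. reflexivity. }
  destruct (bound_exists (fun i => question e (trace c i) 0) (S L)) as [M HM].
  set (d := npair L c). assert (Ed : fst_of d = L /\ snd_of d = c)
    by (unfold d; now rewrite fst_of_npair, snd_of_npair).
  (* The trial node consists of the first [L] entries of the path; [M'] makes the length large
     enough to contain every question consulted. *)
  destruct Ed as [EL Ec]. set (M' := S (M + question e (trace c L) 1)).
  pose proof (npair_ge d M') as [_ Hge].
  exists (npair d M'). unfold avoid_halts. rewrite str_len_prefix, fst_of_npair.
  apply Bool.orb_true_iff. right. apply Bool.andb_true_iff. split.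
  - apply HG. rewrite EL, Ec. exact Hc.
  - apply trial_at_spec. rewrite EL, Ec. split; [lia|]. split.
    + intros i Hi. specialize (HM i). lia.
    + split.
      * rewrite E by lia. now apply Hx.
      * intros i Hi Ha. apply (HL2 i Hi). rewrite E in Ha by lia. now apply Hx.
Qed.

Lemma avoider_avoids n X G :
  (forall d, (forall j, j < fst_of d -> get (snd_of d) j = G j) -> T n d = true) ->
  follows n X ->
  defined (fun i => avoider n i = true) X /\ avoids (app (fun i => avoider n i = true) X).
Proof.
  intros HG HX. destruct (decides_exists X) as [x Hx]. split.
  - apply (defined_prefix _ _ _ Hx). intros q.
    destruct (avoider_total n X x (fst_of q) G HX Hx HG) as [l Hl]. exists l.
    now apply (proj2 (answer_map_code _ _ _ _ _)).
  - intros e. destruct (avoider_total n X x e G HX Hx HG) as [l0 Hl0].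
    destruct (least_exists (fun l => avoid_halts n e (prefix_code x l) = true) l0 Hl0) as [l [Hl1 Hl2]].
    assert (E : forall z, app (fun i => avoider n i = true) X (npair e z) <->
      z = avoid_value e (prefix_code x l)).
    { intros z. etransitivity; [apply (app_prefix _ _ _ _ l Hx)|].
      - split; [apply (proj2 (answer_map_code _ _ _ _ _)); cbn [Nat.eqb]; now rewrite fst_of_npair|].
        intros i Hi Ha. apply (proj1 (answer_map_code _ _ _ _ _)) in Ha. cbn [Nat.eqb] in Ha.
        rewrite fst_of_npair in Ha. exact (Hl2 i Hi Ha).
      - etransitivity; [apply answer_map_code|]. cbn [Nat.eqb].
        now rewrite fst_of_npair, snd_of_npair, Nat.eqb_eq. }
    exists (avoid_value e (prefix_code x l)). split.
    + split; [now apply E|]. intros i Hi Ha. apply E in Ha. lia.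
    + exact (avoider_sound n X x e l HX Hx Hl1).
Qed.

End Tree.

Theorem theorem4 :
  forall S : nat -> Prop,
    Sigma11 S -> many_one_reducible S constructively_true_codes.
Proof.
  intros P HP. destruct (Sigma11_tree P HP) as [T [pr_T [T_closed HT]]].
  destruct (sentence_exists T pr_T) as [F [HF [RF WF]]].
  exists (fun n => form_code (F n)). split; [exact RF|]. intros n. rewrite HT. split.
  - intros [G HG]. exists (F n). split; [reflexivity|]. split; [apply HF|].
    exists (fun x => avoider T n x = true). split.
    + now apply recursive_set_bool, pr_avoider.
    + apply WF. intros X HX. now apply (avoider_avoids T n X G).
  - intros [A [EA [_ [W [RW HW]]]]]. apply form_code_inj in EA. subst A.
    apply NNPP. intros Hn.
    assert (HX : follows T n (fun x => follower T n x = true)).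
    { apply follower_follows; [exact T_closed|]. intros G. apply NNPP. intros H. apply Hn.
      exists G. intros d Hd. apply Bool.not_false_is_true. eauto. }
    destruct (proj1 (WF _ _ _) HW _ HX) as [Hdef Hav].
    apply (no_recursive_dnr W (fun x => follower T n x = true)); auto.
    now apply recursive_set_bool, pr_follower.
Qed.
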